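(* Let $K$ be a convex body in $\mathbb{R}^n$. Then the following hold. (1) The set $F_nK$ is an $L^n$-star; in fact, $\mathrm{Vol}_n(F_nK)=(2\pi)^n$. (2) For $0<p<q\le n$, $$F_pK\subset \mathrm{Vol}_n(K)^{\frac1p-\frac1q}F_qK .$$ Consequently, $F_pK$ is an $L^n$-star for every $p\in(0,n]$. (3) For every $p\in(0,n)$, the functional $K\mapsto \mathrm{Vol}_n(K)^{\frac{p-n}{p}}\,\mathrm{Vol}_n(F_pK)$ is affine-invariant on the set of convex bodies in $\mathbb{R}^n$; that is, its value at $TK+x_0$ equals its value at $K$ for all $T\in \mathrm{GL}_n(\mathbb{R})$ and $x_0\in\mathbb{R}^n$.
   Context: A convex body is a compact convex set with non-empty interior. A set $M\subset\mathbb{R}^n$ is star-shaped if $0\in M$ and $x\in M$ implies $[0,x]\subset M$; its radial function is $\rho_M(\theta)=\sup\{t>0:t\theta\in M\}\in[0,\infty]$ for $\theta\in\mathbb{S}^{n-1}$. Star-shaped sets are specified by their radial functions, and inclusion of such sets is understood as the pointwise inequality of radial functions. $M$ is an $L^n$-star if $\rho_M$ is not identically zero and $\rho_M\in L^n(\mathbb{S}^{n-1})$, equivalently (for $\rho_M\not\equiv0$) $\mathrm{Vol}_n(M)=\frac1n\int_{\mathbb{S}^{n-1}}\rho_M^n(\theta)d\theta<\infty$. For a convex body $K\subset\mathbb{R}^n$ and $p>0$, the Fourier $p$th mean body $F_pK\subset\mathbb{R}^n$ is the origin-symmetric star-shaped set with radial function $$\rho_{F_pK}(\theta)=\left(\frac{p}{\mathrm{Vol}_n(K)}\int_0^\infty|\widehat{\chi_K}(r\theta)|^2r^{p-1}dr\right)^{1/p}\in(0,\infty],\quad\theta\in\mathbb{S}^{n-1},$$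 where $\chi_K$ is the indicator function of $K$ and $\hat f(y)=\int_{\mathbb{R}^n}e^{-i\langle x,y\rangle}f(x)dx$. *)

(* Defs.v *)
From HB Require Import structures.
From mathcomp Require Import all_boot all_order all_algebra.
From mathcomp Require Import all_classical all_reals all_analysis.
From mathcomp Require Import measurable_realfun complex lra.

Set Implicit Arguments.
Unset Strict Implicit.
Unset Printing Implicit Defensive.

Import Order.TTheory GRing.Theory Num.Theory.
Import numFieldNormedType.Exports.

Local Open Scope classical_set_scope.
Local Open Scope ring_scope.

(* The product sigma-algebra on R^n, which is also its Borel sigma-algebra;
   open_measurable_rV below gives the inclusion needed to measure open and
   compact sets. *)
Section measurable_rV.
Context (R : realType) (n : nat).

Let coord : 'I_n -> 'rV[R]_n -> R := fun i x => x ord0 i.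

Let rV0 : g_sigma_preimage coord set0.
Proof. exact: sigma_algebra0. Qed.

Let rVC A : g_sigma_preimage coord A -> g_sigma_preimage coord (~` A).
Proof. exact: sigma_algebraC. Qed.

Let rV_bigcup (F : (set 'rV[R]_n)^nat) :
  (forall i, g_sigma_preimage coord (F i)) ->
  g_sigma_preimage coord (\bigcup_i (F i)).
Proof. exact: sigma_algebra_bigcup. Qed.

HB.instance Definition _ := @isMeasurable.Build default_measure_display
  'rV[R]_n (g_sigma_preimage coord) rV0 rVC rV_bigcup.

End measurable_rV.

Section measurable_rV_lemmas.
Context (R : realType).

Lemma measurable_coord n (i : 'I_n) :
  measurable_fun [set: 'rV[R]_n] (fun x => x ord0 i).
Proof.
move=> _ Y mY; rewrite setTI; apply: sub_sigma_algebra => /=.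
rewrite -bigcup_seq/=; exists i => /=; first by rewrite mem_index_enum.
by exists Y => //; rewrite setTI.
Qed.

Lemma measurable_fun_rVP d (T : measurableType d) n (f : T -> 'rV[R]_n) :
  (forall i, measurable_fun setT (fun x => f x ord0 i)) ->
  measurable_fun setT f.
Proof.
move=> mf; pose c (i : 'I_n) (x : 'rV[R]_n) := x ord0 i.
have : g_sigma_preimage (fun i => c i \o f) `<=` measurable.
  apply: smallest_sub; first exact: sigma_algebra_measurable.
  rewrite -bigcup_seq; apply: bigcup_sub => i _ A [B mB <-].
  exact: mf.
by rewrite g_sigma_preimage_comp => + _ A mA; apply; exists A.
Qed.

Lemma open_measurable_rV n (A : set 'rV[R]_n) : open A -> measurable A.
Proof.
move=> oA.
pose box (qk : 'rV[rat]_n * nat) := [set x : 'rV[R]_n |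
  forall i, `|ratr (qk.1 ord0 i) - x ord0 i| < qk.2.+1%:R^-1].
have mbox qk : measurable (box qk).
  rewrite (_ : box qk = \bigcap_(i in [set: 'I_n])
      (fun x : 'rV[R]_n => x ord0 i) @^-1`
        (ball (ratr (qk.1 ord0 i) : R) qk.2.+1%:R^-1)); last first.
    by apply/seteqP; split=> x /= bx => [i _|i]; exact: bx.
  apply: fin_bigcap_measurable => // i _.
  rewrite -[X in measurable X]setTI; apply: measurable_coord => //.
  exact: measurable_ball.
rewrite (_ : A = \bigcup_(qk in [set qk | box qk `<=` A]) box qk).
  rewrite bigcup_mkcond; apply: countable_bigcupT_measurable => // qk.
  by case: ifPn.
apply/seteqP; split; last by apply: bigcup_sub => qk /=.
move=> x Ax; have /nbhs_ballP[e /= e0 xeA] := open_nbhs_nbhs (conj oA Ax).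
have [k ke] : exists k, k.+1%:R^-1 < e / 2.
  have e2 : 0 < e / 2 by rewrite divr_gt0.
  by have [k] := ltr_add_invr e2; rewrite add0r; exists k.
pose b : R := k.+1%:R^-1.
have b0 : 0 < b by rewrite invr_gt0.
have qP i : exists q : rat, `|ratr q - x ord0 i| < b.
  have [q] := @rat_in_itvoo R (x ord0 i - b) (x ord0 i + b) ltac:(lra).
  by rewrite in_itv/= => qx; exists q; rewrite ltr_distl.
have [q {}qP] := choice qP.
exists (\row_i q i, k) => [y /= yb|i] /=; last by rewrite mxE.
apply: xeA; split=> // j i; rewrite ord1; move: (yb i) (qP i); rewrite mxE.
rewrite /ball /= -/b => y1 y2.
apply: (lt_trans _ (_ : b + b < e)); last by rewrite [e]splitr ltrD.
rewrite -(subrKA (ratr (q i))) (le_lt_trans (ler_normD _ _))//.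
by rewrite distrC ltrD.
Qed.

End measurable_rV_lemmas.

Section lebesgue_rV.
Context (R : realType).
Local Open Scope ereal_scope.

Definition cons_rV n (p : R * 'rV[R]_n) : 'rV[R]_n.+1 :=
  row_mx (p.1)%:M p.2.

(* Lebesgue measure on R^n as the n-fold product of the measure on R. *)
Fixpoint lebesgue_rV (n : nat) : set 'rV[R]_n -> \bar R :=
  match n with
  | 0%N => \d_(0%R : 'rV[R]_0)
  | n'.+1 => pushforward (@lebesgue_measure R \x @lebesgue_rV n') (@cons_rV n')
  end.

Lemma cons_rV_uncons n (x : 'rV[R]_n.+1) :
  cons_rV (x ord0 ord0, \row_i x ord0 (lift ord0 i)) = x.
Proof.
apply/rowP => i; rewrite /cons_rV mxE.
case: splitP => j /= ij; last first.
  by rewrite mxE; congr (x _ _); apply/val_inj.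
by rewrite mxE [j]ord1 eqxx mulr1n; congr (x _ _); apply/val_inj; rewrite /= ij [j]ord1.
Qed.

Lemma measurable_cons_rV n : measurable_fun setT (@cons_rV n).
Proof.
apply: measurable_fun_rVP => i.
rewrite [X in measurable_fun _ X](_ : _ = fun x : R * 'rV[R]_n =>
   match fintype.split (i : 'I_(1 + n)) with inl _ => x.1 | inr j => x.2 ord0 j end); last first.
  apply/funext => x; rewrite /cons_rV mxE.
  by case: splitP => // j _; rewrite mxE [j]ord1 eqxx mulr1n.
case: (fintype.split _) => [_|j]; first exact: measurable_fst.
by apply: (measurableT_comp (measurable_coord j)); exact: measurable_snd.
Qed.

Let uncons n (x : 'rV[R]_n.+1) : R * 'rV[R]_n :=
  (x ord0 ord0, \row_i x ord0 (lift ord0 i)).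

Let measurable_uncons n : measurable_fun setT (@uncons n).
Proof.
apply: measurable_fun_pair; first exact: measurable_coord.
apply: measurable_fun_rVP => i.
by under eq_fun do rewrite mxE; exact: measurable_coord.
Qed.

Let cons_rVK n : cancel (@cons_rV n) (@uncons n).
Proof.
case=> t y; rewrite /uncons /cons_rV/=; congr pair.
  by rewrite mxE; case: splitP => // j _; rewrite mxE [j]ord1 eqxx mulr1n.
apply/rowP => i; rewrite !mxE; case: splitP => [j|j].
  by rewrite [j]ord1.
by rewrite /= /bump leq0n add1n => -[ij]; congr (y _ _); apply/val_inj.
Qed.

Let lebesgue_rV_sigma_finite_measure n :
  {m : {sigma_finite_measure set 'rV[R]_n -> \bar R} |
    m = @lebesgue_rV n :> (set _ -> \bar R)}.
Proof.
elim: n => [|n [m mE]]; first by exists \d_(0%R : 'rV[R]_0).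
pose P : {measure set _ -> \bar R} := (@lebesgue_measure R \x m)%E.
pose M : {measure set _ -> \bar R} :=
  measure_function_pushforward__canonical__measure_function_Measure
    P (@measurable_cons_rV n).
have sM : sigma_finite setT M.
  have /sigma_finiteP[F [TF ndF Foo]] := sigma_finiteT (@lebesgue_measure R).
  have /sigma_finiteP[G [TG ndG Goo]] := sigma_finiteT m.
  exists (fun k => @uncons n @^-1` (F k `*` G k)).
    rewrite -preimage_bigcup (_ : \bigcup_k _ = setT) ?preimage_setT//.
    rewrite -setXTT TF TG predeqE => -[x y]; split.
      by move=> [k _ []/= ? ?]; split; exists k.
    move=> [/= [k _ Fkx] [l _ Gly]]; exists (maxn k l) => //; split.
    - by move: x Fkx; exact/subsetPset/ndF/leq_maxl.
    - by move: y Gly; exact/subsetPset/ndG/leq_maxr.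
  move=> k; have [mF Fy] := Foo k; have [mG Gy] := Goo k; split.
    rewrite -[X in measurable X]setTI; apply: measurable_uncons => //.
    exact: measurableX.
  rewrite /M/= /pushforward -comp_preimage.
  rewrite (_ : @uncons n \o @cons_rV n = id); last exact/funext/cons_rVK.
  by rewrite preimage_id product_measure1E// lte_mul_pinfty// ge0_fin_numE.
pose isM := Measure_isSigmaFinite.Build _ _ _ (M : set _ -> \bar R) sM.
pose M' : {sigma_finite_measure set _ -> \bar R} := HB.pack (M : set _ -> \bar R) M isM.
by exists M'; rewrite /= -mE.
Qed.

Let lebesgue_rV0 n : @lebesgue_rV n set0 = 0.
Proof. by have [m <-] := lebesgue_rV_sigma_finite_measure n. Qed.

Let lebesgue_rV_ge0 n A : 0 <= @lebesgue_rV n A.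
Proof. by have [m <-] := lebesgue_rV_sigma_finite_measure n. Qed.

Let lebesgue_rV_sigma_additive n : semi_sigma_additive (@lebesgue_rV n).
Proof.
have [m <-] := lebesgue_rV_sigma_finite_measure n.
exact: measure_semi_sigma_additive.
Qed.

HB.instance Definition _ n := isMeasure.Build _ _ _ (@lebesgue_rV n)
  (@lebesgue_rV0 n) (@lebesgue_rV_ge0 n) (@lebesgue_rV_sigma_additive n).

Let lebesgue_rV_sigma_finite n : sigma_finite setT (@lebesgue_rV n).
Proof.
have [m <-] := lebesgue_rV_sigma_finite_measure n.
exact: sigma_finiteT.
Qed.

HB.instance Definition _ n := Measure_isSigmaFinite.Build _ _ _
  (@lebesgue_rV n) (@lebesgue_rV_sigma_finite n).

End lebesgue_rV.

Section euclidean.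
Context (R : realType) (n : nat).
Implicit Types x y : 'rV[R]_n.

Definition dotp x y : R := \sum_(i < n) x ord0 i * y ord0 i.

(* The library norm `|x| on row vectors is the sup norm. *)
Definition enorm x : R := Num.sqrt (dotp x x).

Definition sphere : set 'rV[R]_n := [set x | enorm x = 1].

(* The cone measure: n times the volume of the part of the unit ball lying over
   A. On the sphere this is the surface area (the counting measure of {-1, 1}
   when n = 1); the complement of the sphere is a null set. *)
Definition sphere_measure (A : set 'rV[R]_n) : \bar R :=
  (n%:R%:E * lebesgue_rV ([set x | 0 < enorm x <= 1]%R `&`
                          (fun x => (enorm x)^-1 *: x)%R @^-1` A))%E.

Lemma enorm_ge0 x : 0 <= enorm x. Proof. exact: sqrtr_ge0. Qed.

Lemma dotp_ge0 x : 0 <= dotp x x.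
Proof. by apply: sumr_ge0 => i _; rewrite -expr2 sqr_ge0. Qed.

Lemma enorm0 : enorm 0 = 0.
Proof.
by rewrite /enorm /dotp big1 ?sqrtr0// => i _; rewrite mxE mul0r.
Qed.

Lemma enorm_eq0 x : enorm x = 0 -> x = 0.
Proof.
move=> /eqP; rewrite sqrtr_eq0 => x0; apply/rowP => i; rewrite mxE.
have /eqP : dotp x x = 0 by apply/eqP; rewrite eq_le x0 dotp_ge0.
rewrite psumr_eq0; last by move=> j _; rewrite -expr2 sqr_ge0.
by move=> /allP/(_ i (mem_index_enum i)); rewrite /= -expr2 sqrf_eq0 => /eqP.
Qed.

Lemma enormZ (t : R) x : enorm (t *: x) = `|t| * enorm x.
Proof.
rewrite /enorm (_ : dotp _ _ = t ^+ 2 * dotp x x).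
  by rewrite sqrtrM ?sqr_ge0// sqrtr_sqr.
by rewrite mulr_sumr; apply: eq_bigr => i _; rewrite !mxE mulrACA expr2.
Qed.

Lemma measurable_enorm : measurable_fun setT enorm.
Proof.
rewrite (_ : enorm = (fun r => r `^ 2^-1) \o (fun x => dotp x x)); last first.
  by apply/funext => x /=; rewrite powR12_sqrt ?dotp_ge0.
apply: (measurableT_comp (measurable_powR _)).
apply: measurable_sum => i.
by apply: measurable_funM; exact: measurable_coord.
Qed.

Lemma measurable_normalize :
  measurable_fun setT (fun x => (enorm x)^-1 *: x).
Proof.
apply: measurable_fun_rVP => i.
under eq_fun do rewrite mxE.
apply: measurable_funM; last exact: measurable_coord.
rewrite (_ : (fun x => _) = (fun r => r `^ (- 1)) \o enorm); last first.
  by apply/funext => x /=; rewrite powR_inv1 ?enorm_ge0.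
by apply: (measurableT_comp (measurable_powR _)); exact: measurable_enorm.
Qed.

Let pball := [set x | 0 < enorm x <= 1].

Let mpball : measurable pball.
Proof.
rewrite (_ : pball = enorm @^-1` `]0, 1]); last first.
  by apply/seteqP; split=> x /=; rewrite in_itv.
by rewrite -[X in measurable X]setTI; exact: measurable_enorm.
Qed.

Let sphere_measureE : sphere_measure =
  mscale (n%:R%:nng)
    (measure_function_pushforward__canonical__measure_function_Measure
      (mrestr (@lebesgue_rV R n) mpball) measurable_normalize).
Proof.
apply/funext => A.
by rewrite /sphere_measure /mscale /= /pushforward /mrestr setIC.
Qed.

Let sphere_measure0 : sphere_measure set0 = 0%E.
Proof. by rewrite sphere_measureE. Qed.

Let sphere_measure_ge0 A : (0 <= sphere_measure A)%E.
Proof. by rewrite sphere_measureE. Qed.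

Let sphere_measure_sigma_additive : semi_sigma_additive sphere_measure.
Proof. by rewrite sphere_measureE; exact: measure_semi_sigma_additive. Qed.

HB.instance Definition _ := isMeasure.Build _ _ _ sphere_measure
  sphere_measure0 sphere_measure_ge0 sphere_measure_sigma_additive.

End euclidean.

Section fourier.
Context (R : realType) (n : nat).
Local Open Scope complex_scope.

Definition expi (t : R) : R[i] := cos t +i* sin t.

Definition cintegral (f : 'rV[R]_n -> R[i]) : R[i] :=
  (\int[@lebesgue_rV R n]_x complex.Re (f x))%R +i*
  (\int[@lebesgue_rV R n]_x complex.Im (f x))%R.

Definition fourier (f : 'rV[R]_n -> R[i]) (y : 'rV[R]_n) : R[i] :=
  cintegral (fun x => expi (- dotp x y) * f x).

Definition charfun (K : set 'rV[R]_n) (x : 'rV[R]_n) : R[i] := (\1_K x)%:C.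

End fourier.

Section star_sets.
Context (R : realType) (n : nat).
Implicit Types (M N K : set 'rV[R]_n) (rho : 'rV[R]_n -> \bar R).

Definition star_shaped M :=
  M 0 /\ forall x t, M x -> 0 <= t <= 1 -> M (t *: x).

(* The supremum of the empty set is read as 0. *)
Definition radial M (theta : 'rV[R]_n) : \bar R :=
  maxe 0%E (ereal_sup [set t%:E | t in [set t : R | 0 < t /\ M (t *: theta)]]).

(* The star-shaped set with radial function rho on the sphere, containing the
   endpoint of each bounded ray. *)
Definition star_of rho : set 'rV[R]_n :=
  [set x | x = 0 \/ ((enorm x)%:E <= rho ((enorm x)^-1 *: x))%E].

Lemma radial_star_of rho theta : sphere theta -> (0 <= rho theta)%E ->
  radial (star_of rho) theta = rho theta.
Proof.
move=> th1 rho0; have th0 : theta != 0.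
  by apply: contra_eq_neq th1 => ->; rewrite enorm0 eq_sym oner_eq0.
have starE t : 0 < t -> star_of rho (t *: theta) <-> (t%:E <= rho theta)%E.
  move=> t0; rewrite /star_of /= enormZ th1 mulr1 gtr0_norm//.
  rewrite scalerA mulVf ?gt_eqF// scale1r; split; last by right.
  by move=> [/eqP|//]; rewrite scaler_eq0 gt_eqF//= (negbTE th0).
rewrite /radial; apply/eqP; rewrite eq_le ge_max rho0/=; apply/andP; split.
  by apply: ge_ereal_sup => _ [t [t0 /(starE _ t0) ?] <-].
move: rho0 starE; case: (rho theta) => [r||] r0 starE //; last first.
  rewrite le_max; apply/orP; right; rewrite leye_eq; apply/eqP.
  apply/eqyP => A A0; apply: le_ereal_sup_tmp; exists A%:E => //.
  by exists A => //; split => //; apply/starE => //; rewrite leey.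
rewrite le_max; have [->|rN0] := eqVneq r 0; first by rewrite lexx.
apply/orP; right; apply: le_ereal_sup_tmp; exists r%:E => //.
have r_gt0 : 0 < r by rewrite lt_neqAle eq_sym rN0.
by exists r => //; split => //; apply/starE.
Qed.

Definition star_sub M N :=
  forall theta, sphere theta -> (radial M theta <= radial N theta)%E.

Definition Ln_star M :=
  [/\ star_shaped M,
      exists2 theta, sphere theta & radial M theta != 0%E,
      measurable_fun (@sphere R n) (radial M) &
      (\int[@sphere_measure R n]_(theta in @sphere R n)
         (radial M theta `^ n%:R) < +oo)%E].

Definition convex_body K :=
  [/\ compact K, convex_set (K : set (convex_lmodType 'rV[R]_n)) & K° !=set0].

Definition vol M : \bar R := lebesgue_rV M.

Definition fourier_radial (p : R) K (theta : 'rV[R]_n) : \bar R :=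
  (((p / fine (vol K))%:E *
    \int[@lebesgue_measure R]_(r in `]0%R, +oo[)
      (ComplexField.Normc.normc (fourier (charfun K) (r *: theta)) ^+ 2 *
       r `^ (p - 1))%:E)
   `^ p^-1)%E.

Definition fourier_mean_body (p : R) K : set 'rV[R]_n :=
  star_of (fourier_radial p K).

Definition dilate (c : R) M : set 'rV[R]_n := [set c *: x | x in M].

(* Vectors are rows, so a linear map acts by right multiplication. *)
Definition affine_image (T : 'M[R]_n) (x0 : 'rV[R]_n) K : set 'rV[R]_n :=
  [set x *m T + x0 | x in K].

Definition vol_functional (p : R) K : \bar R :=
  ((fine (vol K) `^ ((p - n%:R) / p))%:E * vol (fourier_mean_body p K))%E.

End star_sets.

(* Main.v *)
Require Import Defs.
From mathcomp Require Import all_boot all_order all_algebra.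
From mathcomp Require Import all_classical all_reals all_analysis.
From mathcomp Require Import measurable_realfun complex ring lra.

Set Implicit Arguments.
Unset Strict Implicit.
Unset Printing Implicit Defensive.

Import Order.TTheory GRing.Theory Num.Theory.
Import numFieldNormedType.Exports.

Local Open Scope classical_set_scope.
Local Open Scope ring_scope.

(** Write f for the indicator of K, V for its volume and A(u) for the volume of
    K meet (K - u). The power spectrum |f^|^2 is the Fourier transform of A, so
    integrating it against the Abel kernel exp(- e sum |y_i|), whose transform is
    the product of the 2e / (e^2 + u_i^2), gives the integral over z of
    A(e z) prod 2 / (1 + z_i^2). As e decreases to 0 both sides increase, since K
    is convex, and the limit is Plancherel: |f^|^2 has integral (2 pi)^n V. In
    polar coordinates this is (1).
    On a ray, g(r) = |f^(r theta)|^2 / V^2 lies between 0 and 1, and for such g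
    the map p |-> (p int g(r) r^(p - 1) dr)^(1/p) is nondecreasing: this is (2).
    For (3), the power spectrum of T K + x0 is (det T)^2 |f^ o T^t|^2 (rows
    being vectors, f^(y T^t)), and the radial function of F_p K, extended to
    nonzero vectors by its own formula, is homogeneous of degree -1; hence
    F_p (T K + x0) is the preimage of F_p K under the matrix
    |det T|^(-1/p) T^t. *)

(** * Linear changes of variables *)

(** Signed double integrals would require Fubini's theorem and an integrability check at each
    exchange. They are avoided by keeping the integrands nonnegative: an oscillating factor enters
    as 1 + cos, or as a + b cos with |b| <= a, and the finite term so added is subtracted at the
    end. The measurability of the power spectrum and its bound V^2 come from the same identity. The
    sum of the |y_i| is preferred to the Euclidean norm because its exponential factors over the
    coordinates: the transform reduces to a one-dimensional integral with an explicit primitive, and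
    the mass (2 pi)^n to the arctangent. The substitution u = e z frees the kernel from e and leaves
    e inside A alone, where convexity makes the dependence monotone. In (2) the bound g <= 1 is
    essential: among such functions the indicator of ]0, M] is extremal, and all its means equal M.
    The volume factor is what remains when |f^|^2 is normalised by V^2. *)

Section lebesgue_affine.
Context {R : realType}.
Local Open Scope ereal_scope.
Notation mu := (@lebesgue_measure R).

Lemma measurable_affineR (a b : R) :
  measurable_fun setT (fun t : R => (a * t + b)%R).
Proof. by apply: measurable_funD => //; exact: measurable_funM. Qed.

(** The image of Lebesgue measure under t |-> a t + b, multiplied by |a|, gives every interval ]u,
    v] its length, and this characterises Lebesgue measure. *)
Lemma ge0_integral_affineR (a b : R) (f : R -> \bar R) : a != 0%R ->
  measurable_fun setT f -> (forall t, 0 <= f t) ->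
  \int[mu]_t f t = `|a|%:E * \int[mu]_t f (a * t + b)%R.
Proof.
move=> a0 mf f0.
pose g : R -> measurableTypeR R := fun t => (a * t + b)%R.
have mg : measurable_fun setT g := measurable_affineR a b.
pose P := measure_function_pushforward__canonical__measure_function_Measure mu mg.
pose M : {measure set (measurableTypeR R) -> \bar R} := mscale (NngNum (normr_ge0 a)) P.
transitivity (\int[M]_t f t).
  apply: eq_measure_integral => A mA _; apply: lebesgue_measure_unique => //= _ [[u v]] _ <-.
  rewrite /M /mscale /= /pushforward.
  have : (a > 0 \/ a < 0)%R by apply/orP; rewrite orbC; move: a0; rewrite neq_lt.
  case=> ha.
    rewrite [X in _ * mu X](_ : _ = `]((u - b) / a)%R, ((v - b) / a)%R]%classic); last first.
      apply/seteqP; split => x /=; rewrite /g !in_itv/= ltr_pdivrMr// ler_pdivlMr//;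
      rewrite ltrBlDr lerBrDr; by rewrite [(a * x)%R]mulrC.
    rewrite !lebesgue_measure_itv/= !lte_fin ltr_pM2r ?invr_gt0// ltrD2r.
    case: ifPn; rewrite ?mule0// => _; rewrite -!EFinB -EFinM gtr0_norm//; congr (_%:E).
    by field.
  (* A negative a reverses the order, so the preimage of ]u, v] is closed on the left and open on
     the right. *)
  rewrite [X in _ * mu X](_ : _ = `[((v - b) / a)%R, ((u - b) / a)%R[%classic); last first.
    apply/seteqP; split => x /=; rewrite /g !in_itv/= ltr_ndivlMr// ler_ndivrMr//;
    rewrite ltrBlDr lerBrDr; by rewrite [(a * x)%R]mulrC andbC.
  rewrite !lebesgue_measure_itv/= !lte_fin ltr_nM2r ?invr_lt0// ltrD2r.
  case: ifPn; rewrite ?mule0// => _; rewrite -!EFinB -EFinM ltr0_norm//; congr (_%:E).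
  by field.
rewrite ge0_integral_mscale//=; congr (_ * _).
by rewrite ge0_integral_pushforward.
Qed.

End lebesgue_affine.

Section rV_integral.
Context {R : realType}.
Local Open Scope ereal_scope.
Notation mu := (@lebesgue_measure R).

Lemma ge0_integral_rVS n (f : 'rV[R]_n.+1 -> \bar R) :
  measurable_fun setT f -> (forall x, 0 <= f x) ->
  \int[@lebesgue_rV R n.+1]_x f x =
  \int[mu]_t \int[@lebesgue_rV R n]_y f (cons_rV (t, y)).
Proof.
move=> mf f0.
have -> : \int[@lebesgue_rV R n.+1]_x f x =
   \int[pushforward (mu \x @lebesgue_rV R n) (@cons_rV R n)]_x f x by [].
rewrite ge0_integral_pushforward//; last exact: measurable_cons_rV.
rewrite preimage_setT fubini_tonelli1//; last by move=> x; exact: f0.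
exact: measurableT_comp mf (@measurable_cons_rV R n).
Qed.

Lemma ge0_integral_rVS_swap n (f : 'rV[R]_n.+1 -> \bar R) :
  measurable_fun setT f -> (forall x, 0 <= f x) ->
  \int[@lebesgue_rV R n.+1]_x f x =
  \int[@lebesgue_rV R n]_y \int[mu]_t f (cons_rV (t, y)).
Proof.
move=> mf f0; rewrite ge0_integral_rVS//.
apply: (@fubini_tonelli _ _ _ _ R mu (@lebesgue_rV R n) (f \o @cons_rV R n));
  last by move=> x; exact: f0.
exact: measurableT_comp mf (@measurable_cons_rV R n).
Qed.


Lemma cons_rVD n (s t : R) (y z : 'rV[R]_n) :
  (cons_rV (s, y) + cons_rV (t, z) = cons_rV (s + t, y + z))%R.
Proof.
by rewrite [LHS](@add_row_mx _ 1 1 n s%:M y t%:M z) /cons_rV/= raddfD.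
Qed.

Lemma measurable_fun_cons_rV n d (T : measurableType d)
    (u : T -> R) (v : T -> 'rV[R]_n) :
  measurable_fun setT u -> measurable_fun setT v ->
  measurable_fun setT (fun x => cons_rV (u x, v x)).
Proof.
move=> mu' mv; apply: (measurableT_comp (@measurable_cons_rV R n)).
exact: measurable_fun_pair.
Qed.

Lemma measurable_mulmx m n (A : 'M[R]_(m, n)) :
  measurable_fun setT (fun x : 'rV[R]_m => x *m A).
Proof.
apply: measurable_fun_rVP => i; under eq_fun do rewrite mxE.
by apply: measurable_sum => j; apply: measurable_funM => //; exact: measurable_coord.
Qed.

Lemma measurable_add_rV d (T : measurableType d) n (f g : T -> 'rV[R]_n) :
  measurable_fun setT f -> measurable_fun setT g ->
  measurable_fun setT (fun x => f x + g x)%R.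
Proof.
move=> mf mg; apply: measurable_fun_rVP => i; under eq_fun do rewrite mxE.
by apply: measurable_funD; apply: (measurableT_comp (measurable_coord i)).
Qed.

Lemma measurable_scale_rV d (T : measurableType d) n (u : T -> R)
    (g : T -> 'rV[R]_n) :
  measurable_fun setT u -> measurable_fun setT g ->
  measurable_fun setT (fun x => u x *: g x)%R.
Proof.
move=> mu' mg; apply: measurable_fun_rVP => i; under eq_fun do rewrite mxE.
by apply: measurable_funM => //; apply: (measurableT_comp (measurable_coord i)).
Qed.

Lemma measurable_addr_rV n (b : 'rV[R]_n) :
  measurable_fun setT (fun x : 'rV[R]_n => x + b)%R.
Proof. by apply: measurable_add_rV. Qed.

Lemma ge0_integral_rV_shift n (b : 'rV[R]_n) (f : 'rV[R]_n -> \bar R) :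
  measurable_fun setT f -> (forall x, 0 <= f x) ->
  \int[@lebesgue_rV R n]_x f (x + b)%R = \int[@lebesgue_rV R n]_x f x.
Proof.
elim: n b f => [|n IH] b f mf f0.
  by apply: eq_integral => x _; rewrite [b]thinmx0 addr0.
have mc t : measurable_fun setT (fun y => f (cons_rV (t, y))).
  by apply: (measurableT_comp mf); exact: measurable_fun_cons_rV.
have mfb := measurableT_comp mf (measurable_addr_rV b).
apply: etrans (ge0_integral_rVS mfb (fun x => f0 _)) _ => /=.
rewrite (ge0_integral_rVS mf f0).
rewrite [RHS](ge0_integral_affineR (a := 1) (b ord0 ord0)) ?oner_neq0//; first last.
- by move=> t; exact: integral_ge0.
- apply: (measurable_fun_fubini_tonelli_F (f \o @cons_rV R n)).
    exact: measurableT_comp mf (@measurable_cons_rV R n).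
  by move=> x; exact: f0.
rewrite normr1 mul1e; apply: eq_integral => t _; rewrite mul1r.
rewrite -[RHS](IH (\row_i b ord0 (lift ord0 i))) //.
by apply: eq_integral => y _; rewrite -{1}[b]cons_rV_uncons cons_rVD.
Qed.

(** Stated as a predicate on the matrix because it is stable under products: it then has to be
    checked only on block triangular factors. *)
Definition mx_substitution n (A : 'M[R]_n) :=
  forall f : 'rV[R]_n -> \bar R, measurable_fun setT f -> (forall x, 0 <= f x) ->
  \int[@lebesgue_rV R n]_x f x =
    `|\det A|%:E * \int[@lebesgue_rV R n]_x f (x *m A).

Lemma mx_substitution1 n : mx_substitution (1%:M : 'M[R]_n).
Proof.
move=> f mf f0; rewrite det1 normr1 mul1e.
by apply: eq_integral => x _; rewrite mulmx1.
Qed.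

Lemma mx_substitutionM n (A B : 'M[R]_n) :
  mx_substitution A -> mx_substitution B -> mx_substitution (A *m B).
Proof.
move=> sA sB f mf f0; rewrite sB// sA//; last first.
  exact: measurableT_comp mf (measurable_mulmx B).
rewrite muleA -EFinM -normrM det_mulmx mulrC; congr (_ * _).
by apply: eq_integral => x _; rewrite mulmxA.
Qed.

(** The row (t, y) is sent to (a t, t b + y D). At fixed t the inner integral undergoes [D] and a
    translation by t b; the outer one undergoes t |-> a t. *)
Lemma mx_substitution_ublock n (a : R) (b : 'rV[R]_n) (D : 'M[R]_n) :
  a != 0%R -> mx_substitution D ->
  @mx_substitution n.+1 (block_mx a%:M b 0%R D : 'M[R]_(1 + n)).
Proof.
move=> a0 sD f mf f0.
have mc t : measurable_fun setT (fun y => f (cons_rV (t, y))).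
  by apply: (measurableT_comp mf); exact: measurable_fun_cons_rV.
have mF : measurable_fun setT
    (fun t => \int[@lebesgue_rV R n]_y f (cons_rV (t, y))).
  apply: (measurable_fun_fubini_tonelli_F (f \o @cons_rV R n)).
    exact: measurableT_comp mf (@measurable_cons_rV R n).
  by move=> x; exact: f0.
rewrite ge0_integral_rVS// (ge0_integral_affineR (a := a) 0)//; last first.
  by move=> t; exact: integral_ge0.
have mg := measurableT_comp mf
  (@measurable_mulmx n.+1 n.+1 (block_mx a%:M b 0%R D : 'M[R]_(1 + n))).
rewrite [X in _ = _ * X](ge0_integral_rVS mg (fun x => f0 _)) /=.
rewrite (@det_ublock _ 1 n) det_scalar1 normrM EFinM -muleA; congr (_ * _).
rewrite -ge0_integralZl//; last 2 first.
- apply: (measurable_fun_fubini_tonelli_F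
    ((f \o mulmxr (block_mx a%:M b 0%R D : 'M[R]_(1 + n))) \o @cons_rV R n)).
    exact: measurableT_comp mg (@measurable_cons_rV R n).
  by move=> x; exact: f0.
- by move=> t _; apply: integral_ge0 => y _; exact: f0.
apply: eq_integral => t _; rewrite addr0.
have mct := measurableT_comp (mc (a * t)%R) (measurable_addr_rV (t *: b)).
apply: etrans (esym (ge0_integral_rV_shift (t *: b) (mc (a * t)%R) (fun y => f0 _))) _.
apply: etrans (sD _ mct (fun y => f0 _)) _.
congr (_ * _); apply: eq_integral => y _ /=; congr f.
rewrite /cons_rV/= (@mul_row_block _ 1 1 n 1 n) mul_scalar_mx mulmx0 addr0.
by rewrite scale_scalar_mx mulrC mul_scalar_mx addrC.
Qed.

(** The row (t, y) is sent to (t + y c, y), a translation of t at fixed y; hence the integral over t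
    is taken as the inner one. *)
Lemma mx_substitution_lblock1 n (c : 'cV[R]_n) :
  @mx_substitution n.+1 (block_mx 1%:M 0%R c 1%:M : 'M[R]_(1 + n)).
Proof.
move=> f mf f0.
have mg := measurableT_comp mf
  (@measurable_mulmx n.+1 n.+1 (block_mx 1%:M 0%R c 1%:M : 'M[R]_(1 + n))).
rewrite (@det_lblock _ 1 n) !det1 mulr1 normr1 mul1e.
rewrite (ge0_integral_rVS_swap mf f0) [RHS](ge0_integral_rVS_swap mg (fun x => f0 _)) /=.
apply: eq_integral => y _.
rewrite [LHS](ge0_integral_affineR (a := 1) ((y *m c) ord0 ord0)) ?oner_neq0//; last first.
  by apply: (measurableT_comp mf); exact: measurable_fun_cons_rV.
rewrite normr1 mul1e; apply: eq_integral => t _ /=; congr f.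
rewrite /cons_rV/= (@mul_row_block _ 1 1 n 1 n) !mulmx1 mulmx0 add0r mul1r.
by rewrite raddfD/= -mx11_scalar.
Qed.

(* A block LU factorization when A 0 0 != 0; otherwise a row with nonzero first
   entry is added to the first row. *)
Lemma unitmx_substitution n (A : 'M[R]_n) : A \in unitmx -> mx_substitution A.
Proof.
elim: n A => [A _ f mf f0|n IH].
  rewrite [A]thinmx0 det_mx00 normr1 mul1e; apply: eq_integral => x _.
  by rewrite [x]thinmx0 [RHS](_ : _ = f 0%R)// mul0mx.
have main (A : 'M[R]_(1 + n)) : A \in unitmx -> A ord0 ord0 != 0%R ->
    @mx_substitution n.+1 A.
  move=> uA a0; pose a := A ord0 ord0.
  (* The Schur complement of the corner entry; it is invertible because the determinant of the upper
     factor is a times its own. *)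
  pose D := (drsubmx A - a^-1 *: dlsubmx A *m ursubmx A)%R.
  have ulE : ulsubmx A = a%:M.
    by rewrite [LHS]mx11_scalar !mxE; congr (A _ _)%:M; exact/val_inj.
  have AE : A = block_mx 1%:M 0%R (a^-1 *: dlsubmx A) 1%:M *m
                block_mx a%:M (ursubmx A) 0%R D.
    rewrite mulmx_block !mul1mx !mul0mx !addr0.
    rewrite mul_mx_scalar scalerA divff// scale1r /D addrC subrK -ulE.
    by rewrite submxK.
  have uD : D \in unitmx.
    move: uA; rewrite {1}AE unitmx_mul => /andP[_].
    by rewrite !unitmxE det_ublock unitrM => /andP[].
  rewrite AE; apply: mx_substitutionM; first exact: mx_substitution_lblock1.
  by apply: mx_substitution_ublock => //; exact: IH.
move=> A uA; have [a0|] := eqVneq (A ord0 ord0) 0%R; last exact: main.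
have [i ci0] : exists i : 'I_n, A (lift ord0 i) ord0 != 0%R.
  apply/existsP; rewrite -[X in is_true X]negbK negb_exists; apply/negP => /forallP c0.
  move: uA; rewrite unitmxE (expand_det_col _ ord0) big1 ?unitr0// => j _.
  have [k ->|->] := unliftP ord0 j; last by rewrite a0 mul0r.
  by have /negPn/eqP -> := c0 k; rewrite mul0r.
pose E (s : R) : 'M[R]_(1 + n) := block_mx 1%:M (s *: delta_mx ord0 i) 0%R 1%:M.
have EE s : E (- s)%R *m E s = 1%:M.
  rewrite mulmx_block !mul1mx !mulmx1 !mul0mx mulmx0 !addr0 add0r.
  by rewrite scaleNr subrr -scalar_mx_block.
have sE s : @mx_substitution n.+1 (E s).
  by apply: mx_substitution_ublock; [exact: oner_neq0|exact: mx_substitution1].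
rewrite -[A]mul1mx -(EE 1%R) -mulmxA; apply: mx_substitutionM => //.
have uE : E 1%R \in unitmx by have /mulmx1_unit[] := EE 1%R.
apply: main; first by rewrite unitmx_mul uE.
have -> : (E 1%R *m A) ord0 ord0 = (A (lift ord0 i) ord0)%R.
  pose A' : 'M[R]_(1 + n) := A.
  have EA : E 1%R *m A' = block_mx
      (ulsubmx A' + delta_mx ord0 i *m dlsubmx A')%R
      (ursubmx A' + delta_mx ord0 i *m drsubmx A')%R (dlsubmx A') (drsubmx A').
    rewrite -{1}[A']submxK mulmx_block !mul1mx scale1r.
    by rewrite !mul0mx !add0r.
  transitivity ((E 1%R *m A') (lshift n ord0) (lshift n ord0)).
    by congr ((E 1%R *m A) _ _); exact/val_inj.
  rewrite EA block_mxEul mxE -rowE !mxE.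
  rewrite [X in (X + _)%R](_ : _ = 0%R); last first.
    by rewrite -a0; congr (A _ _); exact/val_inj.
  by rewrite add0r; congr (A _ _); exact/val_inj.
exact: ci0.
Qed.

End rV_integral.

(** * Polar coordinates *)

Section powR_integrals.
Context {R : realType}.
Notation mu := (@lebesgue_measure R).

Lemma continuous_powR (p x : R) : 0 < x -> {for x, continuous (@powR R ^~ p)}.
Proof.
move=> x0; apply/differentiable_continuous/derivable1_diffP.
by apply: ex_derive; exact: is_derive1_powR.
Qed.

Lemma is_derive_powRZ (c p x : R) : 0 < x ->
  is_derive x 1 (fun s : R => c * s `^ p) (c * (p * x `^ (p - 1))).
Proof. by move=> x0; apply: is_deriveZ; exact: is_derive1_powR. Qed.

Lemma powRN_cvgy (q : R) : 0 < q -> s `^ (- q) @[s --> +oo] --> (0 : R).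
Proof.
move=> q0; apply/cvgrPdist_le => e e0.
near=> s; rewrite sub0r normrN ger0_norm ?powR_ge0//.
have s0 : 0 < s by near: s; exact: nbhs_pinfty_gt.
have es : e `^ (- q^-1) <= s by near: s; exact: nbhs_pinfty_ge.
rewrite powRN -[leRHS]invrK lef_pV2 ?posrE ?invr_gt0 ?powR_gt0//.
rewrite (_ : e^-1 = (e `^ (- q^-1)) `^ q); last first.
  by rewrite -powRrM mulNr mulVf ?gt_eqF// powR_inv1// ltW.
by rewrite ge0_ler_powR ?nnegrE ?powR_ge0 ?ltW.
Unshelve. all: by end_near. Qed.

Lemma integral_powR_itvcy (a q : R) : 0 < a -> 0 < q ->
  (\int[mu]_(s in `[a, +oo[) (s `^ (- q - 1))%:E = (a `^ (- q) / q)%:E)%E.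
Proof.
move=> a0 q0; rewrite (@ge0_continuous_FTC2y _ _ (fun s => (- q^-1) * s `^ (- q)) _ 0).
- by rewrite -EFinB sub0r mulNr opprK mulrC.
- by move=> x _; exact: powR_ge0.
- apply: continuous_in_subspaceT => x; rewrite inE/= in_itv/= andbT => ax.
  by apply: continuous_powR; exact: lt_le_trans ax.
- by rewrite -[0](mulr0 (- q^-1)); apply: cvgMr; exact: powRN_cvgy.
- move=> x ax; apply: ex_derive.
  by apply: is_derive_powRZ; exact: lt_trans ax.
- apply: cvgMr; apply: cvg_at_right_filter; exact: continuous_powR.
- move=> x; rewrite in_itv/= andbT => ax; have x0 := lt_trans a0 ax.
  have dx := is_derive_powRZ (- q^-1) (- q) x0.
  by rewrite derive1E derive_val; field; rewrite gt_eqF.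
Qed.

Lemma integral_powR_itvcc (a b p : R) : 0 < a -> a < b -> 0 < p ->
  (\int[mu]_(s in `[a, b]) (s `^ (p - 1))%:E = (b `^ p / p - a `^ p / p)%:E)%E.
Proof.
move=> a0 ab p0; rewrite (@continuous_FTC2 _ _ (fun s => p^-1 * s `^ p))//.
- by rewrite -EFinB ![p^-1 * _]mulrC.
- apply: continuous_in_subspaceT => x; rewrite inE/= in_itv/= => /andP[ax _].
  by apply: continuous_powR; exact: lt_le_trans ax.
- split.
  + move=> x; rewrite in_itv/= => /andP[ax _]; apply: ex_derive.
    by apply: is_derive_powRZ; exact: lt_trans ax.
  + by apply: cvgMr; apply: cvg_at_right_filter; exact: continuous_powR.
  + apply: cvgMr; apply: cvg_at_left_filter; apply: continuous_powR.
    exact: lt_trans ab.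
- move=> x; rewrite in_itv/= => /andP[ax _]; have x0 := lt_trans a0 ax.
  have dx := is_derive_powRZ p^-1 p x0.
  by rewrite derive1E derive_val; field; rewrite gt_eqF.
Qed.

Lemma integral_powR_itvoc (b p : R) : 0 < b -> 0 < p ->
  (\int[mu]_(s in `]0%R, b]) (s `^ (p - 1))%:E = (b `^ p / p)%:E)%E.
Proof.
move=> b0 p0.
(* For p < 1 the integrand is unbounded near 0, so ]0, b] is exhausted by compact intervals on which
   the fundamental theorem of calculus applies. The denominators start at 2 to have b / (k + 2) <
   b. *)
pose F (k : nat) : set R := `[b / k.+2%:R, b]%classic.
have FE : `]0%R, b]%classic = \bigcup_k F k.
  apply/seteqP; split => [x/=|x [k _]]; rewrite /F/= !in_itv/=.
    move=> /andP[x0 xb]; have [k kx] : exists k : nat, b / x < k%:R.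
      exists (Num.truncn (b / x)).+1; exact: truncnS_gt.
    exists k => //=; rewrite in_itv/= xb andbT ler_pdivrMr//.
    rewrite -ler_pdivrMl// mulrC (le_trans (ltW kx))// ler_nat.
    by rewrite (leq_trans (leqnSn _)).
  by move=> /andP[/lt_le_trans -> //]; rewrite divr_gt0.
have ndF : nondecreasing_seq F.
  move=> m n mn; rewrite subsetEset => x; rewrite /F/= !in_itv/= => /andP[mx ->].
  rewrite andbT (le_trans _ mx)// ler_pM2l// lef_pV2 ?posrE//.
  by rewrite ler_nat !ltnS.
have mf k : measurable_fun (F k) (fun s => (s `^ (p - 1))%:E).
  by apply/measurable_EFinP; apply: measurable_funTS; exact: measurable_powR.
have f0 k x : F k x -> (0 <= (x `^ (p - 1))%:E)%E by rewrite lee_fin powR_ge0.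
have mF k : measurable (F k) by exact: measurable_itv.
have := @ge0_nondecreasing_set_cvg_integral _ (measurableTypeR R) R F
  (fun s => (s `^ (p - 1))%:E) mu ndF mF mf f0.
rewrite -FE => /cvg_lim <-//; apply/cvg_lim => //.
rewrite (_ : (fun _ => _) =
    EFin \o (fun k => b `^ p / p - b `^ p / p * k.+2%:R `^ (- p))); last first.
  apply/funext => k /=; rewrite integral_powR_itvcc//; first last.
  - by rewrite ltr_pdivrMr// ltr_pMr// ltr1n.
  - by rewrite divr_gt0.
  rewrite powRM ?invr_ge0// ?(ltW b0)// -[k.+2%:R^-1]powR_inv1// -powRrM mulN1r.
  by congr (_%:E); ring.
apply: cvg_EFin; first exact: nearW.
rewrite -[X in _ --> X]subr0; apply: cvgB; first exact: cvg_cst.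
rewrite -[X in _ --> X](mulr0 (b `^ p / p)); apply: cvgMr.
apply: (cvg_comp (fun k : nat => k.+2%:R : R) (fun s => s `^ (- p)) _ (powRN_cvgy p0)).
apply/cvgryPge => A; near=> k.
rewrite (@le_trans _ _ k%:R)//; last by rewrite ler_nat (leq_trans (leqnSn _)).
by near: k; exact: nbhs_infty_ger.
Unshelve. all: by end_near. Qed.

End powR_integrals.

Section integral_indic_mul.
Local Open Scope ereal_scope.
Context d (T : measurableType d) (R : realType).
Implicit Types (m : {measure set T -> \bar R}) (f : T -> \bar R).

Lemma integral_indicM m (D : set T) f :
  \int[m]_(x in D) f x = \int[m]_x ((\1_D x)%:E * f x).
Proof.
rewrite integral_mkcond; apply: eq_integral => x _.
by rewrite patchE indicE; case: (x \in D); rewrite ?mul1e ?mul0e.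
Qed.

Lemma ge0_integral_mrestr m (D E : set T) (mD : measurable D) f :
  measurable E -> measurable_fun E f -> (forall x, E x -> 0 <= f x) ->
  \int[mrestr m mD]_(x in E) f x = \int[m]_(x in E `&` D) f x.
Proof.
move=> mE mf f0; have D0 : mrestr m mD (~` D) = 0 by rewrite /mrestr setICl measure0.
rewrite (ge0_negligible_integral (measurableC mD) mE mf f0 D0).
rewrite setDE setCK; apply: eq_measure_integral => A mA AED.
by rewrite /= /mrestr (setIidl (subset_trans AED _))// => x [].
Qed.

Lemma measurable_indic_comp d' (U : measurableType d') (D : set T) (u : U -> T) :
  measurable D -> measurable_fun setT u ->
  measurable_fun setT (fun x => \1_D (u x) : R).
Proof. by move=> mD mu'; apply: measurableT_comp => //; exact: measurable_indic. Qed.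

Lemma measurable_powR_comp d' (U : measurableType d') (u : U -> R) (p : R) :
  measurable_fun setT u -> measurable_fun setT (fun x => u x `^ p)%R.
Proof. by move=> mu'; exact: (measurableT_comp (measurable_powR p) mu'). Qed.

End integral_indic_mul.

Section polar.
Context {R : realType}.
Local Open Scope ereal_scope.
Notation mu := (@lebesgue_measure R).
Implicit Type n : nat.

Lemma ge0_integral_rV_scale n (c : R) (f : 'rV[R]_n -> \bar R) : (c != 0)%R ->
  measurable_fun setT f -> (forall x, 0 <= f x) ->
  \int[@lebesgue_rV R n]_x f x =
  (`|c| ^+ n)%:E * \int[@lebesgue_rV R n]_x f (c *: x)%R.
Proof.
move=> c0 mf f0; rewrite (@unitmx_substitution _ _ c%:M)//; last first.
  by rewrite unitmxE det_scalar unitrX// unitfE.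
rewrite det_scalar normrX; congr (_ * _).
by apply: eq_integral => x _; rewrite mul_mx_scalar.
Qed.

Lemma measurable_enorm_comp d (T : measurableType d) n (u : T -> 'rV[R]_n) :
  measurable_fun setT u -> measurable_fun setT (fun x => enorm (u x)).
Proof. exact: (measurableT_comp (@measurable_enorm R n)). Qed.

Lemma enorm_gt0 n (x : 'rV[R]_n) : (0 < enorm x)%R = (x != 0%R).
Proof.
rewrite lt_neqAle enorm_ge0 andbT eq_sym; congr negb.
by apply/eqP/eqP => [/enorm_eq0//|->]; rewrite enorm0.
Qed.

Lemma measurable_rV0 n : measurable [set 0%R : 'rV[R]_n].
Proof.
rewrite (_ : [set 0%R] = (@enorm R n) @^-1` [set 0%R]).
  by rewrite -[X in measurable X]setTI; exact: measurable_enorm.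
by apply/seteqP; split => x /=; [move=> ->; rewrite enorm0|exact: enorm_eq0].
Qed.

(** In dimension 0 the measure is a Dirac mass and the claim fails. Otherwise each slice in the
    first coordinate has at most one point. *)
Lemma lebesgue_rV_set0 n : (0 < n)%N -> lebesgue_rV [set 0%R : 'rV[R]_n] = 0.
Proof.
case: n => // n _; rewrite -[X in lebesgue_rV X]setIT -integral_indic//; last first.
  exact: measurable_rV0.
rewrite ge0_integral_rVS_swap//; last first.
  by apply/measurable_EFinP; apply: measurable_indic; exact: measurable_rV0.
rewrite integral0_eq// => y _.
rewrite -[RHS](@integral_Sset1 R (fun t => (\1_[set 0%R] (cons_rV (t, y)))%:E) [set 0%R] 0%R)//.
rewrite [RHS]integral_mkcond; apply: eq_integral => t _; rewrite patchE.
case: ifPn => // /negP t0; rewrite indicE memNset//= => ty0; apply: t0.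
rewrite inE/=; have := congr1 (fun x : 'rV[R]_n.+1 => x ord0 ord0) ty0.
by rewrite /cons_rV/= !mxE; case: splitP => // j _; rewrite mxE [j]ord1 eqxx mulr1n.
Qed.

Definition pball n := [set x : 'rV[R]_n | 0 < enorm x <= 1]%R.
Arguments pball : clear implicits.

Lemma pballE n : pball n = (@enorm R n) @^-1` `]0%R, 1%R].
Proof. by apply/seteqP; split=> x /=; rewrite in_itv. Qed.

Lemma measurable_pball n : measurable (pball n).
Proof.
rewrite pballE -[X in measurable X]setTI; exact: measurable_enorm.
Qed.

Lemma measurable_sphere n : measurable (@sphere R n).
Proof.
rewrite (_ : @sphere R n = (@enorm R n) @^-1` [set 1%R]); last by [].
by rewrite -[X in measurable X]setTI; exact: measurable_enorm.
Qed.

Lemma normalize_sphere n (x : 'rV[R]_n) : (0 < enorm x)%R ->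
  sphere ((enorm x)^-1 *: x)%R.
Proof.
move=> x0; rewrite /sphere/= enormZ ger0_norm ?invr_ge0 ?enorm_ge0//.
by rewrite mulVf// gt_eqF.
Qed.

(** The cone measure is n times the image, under normalisation, of Lebesgue measure on the punctured
    unit ball. Normalisation sends that ball into the sphere, so restricting to the sphere loses
    nothing. *)
Lemma ge0_integral_sphere n (f : 'rV[R]_n -> \bar R) :
  measurable_fun setT f -> (forall x, 0 <= f x) ->
  \int[@sphere_measure R n]_(x in @sphere R n) f x =
  n%:R%:E * \int[@lebesgue_rV R n]_(x in pball n) f ((enorm x)^-1 *: x)%R.
Proof.
move=> mf f0.
pose P := measure_function_pushforward__canonical__measure_function_Measure
  (mrestr (@lebesgue_rV R n) (@measurable_pball n)) (@measurable_normalize R n).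
transitivity (\int[mscale (n%:R%:nng)%R P]_(x in @sphere R n) f x).
  apply: eq_measure_integral => A mA _.
  exact: (congr1 (fun B => n%:R%:E * lebesgue_rV B) (setIC _ _)).
have mS := @measurable_sphere n.
have mfS : measurable_fun (@sphere R n) f by exact: measurable_funTS.
rewrite ge0_integral_mscale//; congr (_ * _).
rewrite ge0_integral_pushforward//; last exact: measurable_normalize.
rewrite ge0_integral_mrestr//; first last.
- by move=> x _; exact: f0.
- by apply: measurable_funTS; exact: measurableT_comp mf (@measurable_normalize R n).
- by rewrite -[X in measurable X]setTI; exact: measurable_normalize.
rewrite setIidr// => x /andP[x0 _]; exact: normalize_sphere.
Qed.

(* Substituting r = s |x| and then y = s x, the right-hand side becomes the
   integral of h(y) against n |y|^n int_(s >= |y|) s^(- n - 1) ds = 1. *)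
Lemma ge0_integral_polar n (h : 'rV[R]_n -> \bar R) : (0 < n)%N ->
  measurable_fun setT h -> (forall x, 0 <= h x) ->
  \int[@lebesgue_rV R n]_x h x =
  \int[@sphere_measure R n]_(x in @sphere R n)
    \int[mu]_(r in `]0%R, +oo[) ((r `^ (n%:R - 1))%:E * h (r *: x)%R).
Proof.
move=> n0 mh h0; have n0R : (0 < n%:R :> R)%R by rewrite ltr0n.
pose i0 (s : R) : R := \1_`]0%R, +oo[ s.
have i00 s : (0 <= i0 s)%R by [].
pose i1 (s : R) : R := \1_`[0%R, +oo[ s.
have i10 s : (0 <= i1 s)%R by [].
pose ib (s : R) : R := \1_`]0%R, 1%R] s.
have ib0 s : (0 <= ib s)%R by [].
(* The weight after r = s |x|: (s |x|)^(n - 1) |x| is s^(n - 1) |x|^n. Domains are encoded by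
   indicator factors so that Tonelli's theorem applies on the whole product space. *)
pose G0 (z : R * 'rV[R]_n) := (i0 z.1 * ib (enorm z.2) *
  (z.1 `^ (n%:R - 1) * enorm z.2 `^ n%:R))%R.
pose G z := (G0 z)%:E * h (z.1 *: z.2)%R.
(* The weight after y = s x: both |x|^n and dx contribute a factor s^(- n), and |x| <= 1 becomes |y|
   <= s. *)
pose H0 (z : R * 'rV[R]_n) := (i0 z.1 * (i0 (enorm z.2) * i1 (z.1 - enorm z.2)) *
  (z.1 `^ (- n%:R - 1) * enorm z.2 `^ n%:R))%R.
pose H z := (H0 z)%:E * h z.2.
have G00 z : (0 <= G z).
  by rewrite mule_ge0// lee_fin !mulr_ge0// powR_ge0.
have H00 z : (0 <= H z).
  by rewrite mule_ge0// lee_fin !mulr_ge0// powR_ge0.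
have mi0 d (T : measurableType d) (u : T -> R) :
  measurable_fun setT u -> measurable_fun setT (fun x => i0 (u x)).
  exact: measurable_indic_comp.
have mi1 d (T : measurableType d) (u : T -> R) :
  measurable_fun setT u -> measurable_fun setT (fun x => i1 (u x)).
  exact: measurable_indic_comp.
have mib d (T : measurableType d) (u : T -> R) :
  measurable_fun setT u -> measurable_fun setT (fun x => ib (u x)).
  exact: measurable_indic_comp.
have mG : measurable_fun setT G.
  apply: emeasurable_funM.
    apply/measurable_EFinP; apply: measurable_funM.
      by apply: measurable_funM; [exact: mi0|apply: mib; exact: measurable_enorm_comp].
    apply: measurable_funM; first exact: measurable_powR_comp.
    by apply: measurable_powR_comp; exact: measurable_enorm_comp.
  by apply: (measurableT_comp mh); exact: measurable_scale_rV.
have mH : measurable_fun setT H.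
  apply: emeasurable_funM; last exact: (measurableT_comp mh).
  apply/measurable_EFinP; apply: measurable_funM.
    apply: measurable_funM; first exact: mi0.
    apply: measurable_funM; first by apply: mi0; exact: measurable_enorm_comp.
    by apply: mi1; apply: measurable_funB => //; exact: measurable_enorm_comp.
  apply: measurable_funM; first exact: measurable_powR_comp.
  by apply: measurable_powR_comp; exact: measurable_enorm_comp.
have i0E s : i0 s = ((0 < s)%R%:R)%R.
  by rewrite /i0 indicE mem_setE in_itv/= andbT.
have i1E s : i1 s = ((0 <= s)%R%:R)%R.
  by rewrite /i1 indicE mem_setE in_itv/= andbT.
have ibE s : ib s = ((0 < s <= 1)%R%:R)%R by rewrite /ib indicE mem_setE in_itv.
have pbE x : \1_(pball n) x = ((0 < enorm x <= 1)%R%:R : R)%R.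
  by rewrite indicE; congr (nat_of_bool _)%:R; apply/idP/idP; rewrite inE.
pose J (z : R * 'rV[R]_n) :=
  (i0 z.1)%:E * ((z.1 `^ (n%:R - 1))%:E * h (z.1 *: z.2)%R).
have J0 z : 0 <= J z by rewrite /J mule_ge0 ?mule_ge0 ?lee_fin ?powR_ge0.
have mJ : measurable_fun setT J.
  apply: emeasurable_funM; first by apply/measurable_EFinP; exact: mi0.
  apply: emeasurable_funM; first by apply/measurable_EFinP; exact: measurable_powR_comp.
  by apply: (measurableT_comp mh); exact: measurable_scale_rV.
under [RHS]eq_integral do rewrite integral_indicM.
rewrite ge0_integral_sphere; first last.
- by move=> x; apply: integral_ge0 => r _; exact: (J0 (r, x)).
- exact: (@measurable_fun_fubini_tonelli_G _ _ _ _ R mu J mJ J0).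
rewrite [in X in _ = _ * X]integral_indicM.
transitivity (n%:R%:E * \int[@lebesgue_rV R n]_x \int[mu]_s G (s, x)); last first.
  congr (_ * _).
  apply: eq_integral => x _; rewrite pbE.
  have [x01|x01] := boolP (0 < enorm x <= 1)%R; last first.
    rewrite mul0e integral0_eq// => s _.
    by rewrite /G /G0/= ibE (negbTE x01) mulr0 !mul0r mul0e.
  have [x0 x1] := andP x01; rewrite mul1e.
  have mJx : measurable_fun setT (fun r => J (r, (enorm x)^-1 *: x)%R).
    by apply: (measurableT_comp mJ); exact: measurable_fun_pair.
  rewrite [RHS](ge0_integral_affineR (a := enorm x) 0 _ mJx) ?gt_eqF//.
  have mJx' := measurableT_comp mJx (measurable_affineR (enorm x) 0).
  rewrite gtr0_norm// -ge0_integralZl//; last by rewrite lee_fin enorm_ge0.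
  apply: eq_integral => s _.
  rewrite /G /G0 /J/= addr0 !i0E ibE x01 pmulr_rgt0//.
  have [s0|s0] := ltP 0%R s; last by rewrite !mul0r !mul0e mule0.
  rewrite !mul1r mul1e muleA -EFinM scalerA; congr (_%:E * h _).
    by rewrite powRM ?enorm_ge0 ?(ltW s0)// mulrA mulr_powRB1 ?enorm_ge0// mulrC.
  by rewrite mulrAC divff ?gt_eqF// mul1r.
rewrite -(@fubini_tonelli _ _ _ _ R mu (@lebesgue_rV R n) G mG G00).
have GH s : \int[@lebesgue_rV R n]_x G (s, x) = \int[@lebesgue_rV R n]_x H (s, x).
  have [s0|s0] := ltP 0%R s; last first.
    rewrite !integral0_eq// => x _; rewrite /G /H /G0 /H0/= i0E ltNge s0.
      by rewrite !mul0r mul0e.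
    by rewrite !mul0r mul0e.
  have mHs : measurable_fun setT (fun x => H (s, x)).
    by apply: (measurableT_comp mH); exact: measurable_fun_pair.
  rewrite [RHS](ge0_integral_rV_scale (c := s)) ?gt_eqF//.
  have mHs' : measurable_fun setT (fun x : 'rV[R]_n => H (s, s *: x)%R).
    by apply: (measurableT_comp mHs); exact: measurable_scale_rV.
  rewrite -ge0_integralZl//.
  apply: eq_integral => x _; rewrite /G /H /G0 /H0/= muleA -EFinM; congr (_%:E * _).
  rewrite !i0E i1E ibE enormZ s0 gtr0_norm// pmulr_rgt0// subr_ge0.
  rewrite ger_pMr// -mulnb natrM !mul1r [RHS]mulrCA; congr (_ * _)%R.
  rewrite powRM ?enorm_ge0 ?(ltW s0)// !mulrA; congr (_ * _)%R.
  rewrite -powR_mulrn ?(ltW s0)// -!powRD ?(gt_eqF s0) ?implybT//.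
  by congr (_ `^ _)%R; ring.
under [X in _ = _ * X]eq_integral do rewrite GH.
rewrite (@fubini_tonelli _ _ _ _ R mu (@lebesgue_rV R n) H mH H00).
have HE y : y != 0%R -> \int[mu]_s H (s, y) = (n%:R^-1)%:E * h y.
  rewrite -enorm_gt0 => y0.
  transitivity (\int[mu]_s ((enorm y `^ n%:R)%:E * h y *
     ((\1_`[enorm y, +oo[ s)%:E * (s `^ (- n%:R - 1))%:E))).
    apply: eq_integral => s _; rewrite /H /H0/= !i0E i1E y0 subr_ge0.
    rewrite indicE mem_setE in_itv/= andbT mul1r.
    have [ys|] := leP (enorm y) s; last by rewrite mulr0 !mul0r mul0e mul0e mule0.
    by rewrite (lt_le_trans y0 ys) !mul1r mul1e EFinM [RHS]muleC muleA.
  have mu1 : measurable_fun setT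
      (fun s : R => (\1_`[enorm y, +oo[ s)%:E * (s `^ (- n%:R - 1))%:E).
    apply: emeasurable_funM; apply/measurable_EFinP; last exact: measurable_powR_comp.
    exact: measurable_indic.
  rewrite ge0_integralZl//; last 2 first.
  - by move=> s _; rewrite mule_ge0// lee_fin powR_ge0.
  - by rewrite mule_ge0// lee_fin powR_ge0.
  rewrite -integral_indicM integral_powR_itvcy// [in LHS]muleAC -EFinM; congr (_%:E * _).
  by rewrite powRN mulrA divff ?mul1r// gt_eqF// powR_gt0.
have mK : measurable_fun setT (fun y => \int[mu]_s H (s, y)).
  exact: (@measurable_fun_fubini_tonelli_G _ _ _ _ R mu H mH H00).
(* The radial integral was evaluated at y != 0 only; the origin is a null set because n > 0. *)
rewrite (ge0_negligible_integral (@measurable_rV0 n) measurableT mh)//; last first.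
  exact: lebesgue_rV_set0.
rewrite (ge0_negligible_integral (@measurable_rV0 n) measurableT mK)//; first last.
- exact: lebesgue_rV_set0.
- by move=> y _; exact: integral_ge0.
rewrite [in X in _ = _ * X](eq_integral (fun y => (n%:R^-1)%:E * h y)); last first.
  move=> y; rewrite inE/= => -[_ /eqP y0].
 exact: HE.
have mD : measurable ([set: 'rV[R]_n] `\ 0%R).
  by apply: measurableD => //; exact: measurable_rV0.
rewrite ge0_integralZl//; last exact: measurable_funTS.
by rewrite muleA -EFinM divff ?gt_eqF// mul1e.
Qed.

End polar.

(** * The Abel kernel and its Fourier transform *)

Section abel_kernel_1d.
Context {R : realType}.
Notation mu := (@lebesgue_measure R).

Lemma ge0_integral_reflect (g : R -> \bar R) : (forall t, 0 <= g t)%E ->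
  measurable_fun setT g ->
  (\int[mu]_t g t = \int[mu]_(t in `[0%R, +oo[) (g t + g (- t)%R))%E.
Proof.
move=> g0 mg; have mgN : measurable_fun setT (fun t : R => g (- t)).
  by apply: (measurableT_comp mg); exact: oppr_measurable.
have -> : [set: R] = `]-oo, 0[%classic `|` `[0, +oo[%classic by rewrite -setCitvl setUv.
rewrite ge0_integral_setU//=; last 2 first.
- exact: measurable_funTS.
- by rewrite -setCitvl disj_set2E setICr.
rewrite ge0_integralD//=; last 2 first.
- exact: measurable_funTS.
- exact: measurable_funTS.
rewrite addeC; congr (_ + _)%E.
rewrite -[RHS]integral_itv_obnd_cbnd; last exact: measurable_funTS.
rewrite [LHS]integral_indicM [RHS]integral_indicM.
rewrite (ge0_integral_affineR (a := -1) 0) ?oppr_eq0 ?oner_eq0//; last 2 first.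
- apply: emeasurable_funM => //; apply/measurable_EFinP; exact: measurable_indic.
- by move=> t; rewrite mule_ge0// lee_fin.
rewrite normrN normr1 mul1e; apply: eq_integral => t _.
rewrite addr0 mulN1r !indicE !mem_setE !in_itv/= andbT.
by rewrite oppr_lt0.
Qed.

Lemma is_derive_expRZ (e t : R) :
  is_derive t 1 (fun t => expR (- e * t)) (- e * expR (- e * t)).
Proof.
have d : is_derive t 1 (fun t => - e * t) (- e).
  by apply: (is_derive_eq (is_deriveZ (- e) (is_derive_id t 1))); rewrite /GRing.scale/= mulr1.
by apply: (is_derive_eq (is_derive1_comp (is_derive_expR _) d)); rewrite mulrC.
Qed.

Lemma is_derive_sinZ (u t : R) :
  is_derive t 1 (fun t => sin (u * t)) (u * cos (u * t)).
Proof.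
have d : is_derive t 1 (fun t => u * t) u.
  by apply: (is_derive_eq (is_deriveZ u (is_derive_id t 1))); rewrite /GRing.scale/= mulr1.
by apply: (is_derive_eq (is_derive1_comp (is_derive_sin _) d)); rewrite mulrC.
Qed.

Lemma is_derive_cosZ (u t : R) :
  is_derive t 1 (fun t => cos (u * t)) (- u * sin (u * t)).
Proof.
have d : is_derive t 1 (fun t => u * t) u.
  by apply: (is_derive_eq (is_deriveZ u (is_derive_id t 1))); rewrite /GRing.scale/= mulr1.
by apply: (is_derive_eq (is_derive1_comp (is_derive_cos _) d)); rewrite mulrC mulrN mulNr.
Qed.

Lemma is_derive_continuous (f : R -> R) (x a : R) :
  is_derive x 1 f a -> {for x, continuous f}.
Proof.
by move=> d; apply/differentiable_continuous/derivable1_diffP; exact: ex_derive.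
Qed.

Lemma normM_cos_le (a b x : R) : `|b| <= a -> `|b * cos x| <= a.
Proof.
move=> ba; rewrite normrM (le_trans _ ba)// ler_piMr//.
by rewrite ler_norml cos_geN1 cos_le1.
Qed.

Lemma addr_mul_cos_ge0 (a b x : R) : `|b| <= a -> 0 <= a + b * cos x.
Proof. by move=> /(normM_cos_le x); rewrite ler_norml => /andP[]; lra. Qed.

(** The bound |b| <= a makes the integrand nonnegative, so the fundamental theorem of calculus on a
    half-line applies without a separate integrability argument. *)
Lemma integral0y_expR_cos (e u a b : R) : 0 < e -> `|b| <= a ->
  (\int[mu]_(t in `[0%R, +oo[) (expR (- e * t) * (a + b * cos (u * t)))%:E =
   (a / e + b * e / (e ^+ 2 + u ^+ 2))%:E)%E.
Proof.
move=> e0 ba.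
have eu0 : 0 < e ^+ 2 + u ^+ 2 by rewrite ltr_wpDr ?sqr_ge0// exprn_gt0.
have enz : e != 0 by rewrite gt_eqF.
have eunz : e ^+ 2 + u ^+ 2 != 0 by rewrite gt_eqF.
pose c := b / (e ^+ 2 + u ^+ 2).
(* Together with the exponential factor of [F], the second term is b times the real part of exp ((-
   e + i u) t) / (- e + i u). *)
pose P (t : R) : R := - (a / e) + c * (u * sin (u * t) - e * cos (u * t)).
pose F (t : R) : R := expR (- e * t) * P t.
have dP (t : R) : is_derive t 1 P (c * (u * (u * cos (u * t)) - e * (- u * sin (u * t)))).
  have d1 := is_deriveZ u (is_derive_sinZ u t).
  have d2 := is_deriveZ e (is_derive_cosZ u t).
  have d3 := is_deriveZ c (is_deriveB d1 d2).
  by apply: (is_derive_eq (is_deriveD (@is_derive_cst R R R (- (a / e)) t 1) d3)); rewrite add0r.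
have dF (t : R) : is_derive t 1 F (expR (- e * t) * (a + b * cos (u * t))).
  apply: (is_derive_eq (is_deriveM (is_derive_expRZ e t) (dP t))).
  by rewrite /GRing.scale/= /P /c; field; rewrite enz eunz.
have cf : continuous (fun t => expR (- e * t) * (a + b * cos (u * t))).
  move=> t; apply: cvgM; first exact: (is_derive_continuous (is_derive_expRZ e t)).
  apply: cvgD; first exact: cvg_cst.
  by apply: cvgMr; exact: (is_derive_continuous (is_derive_cosZ u t)).
rewrite (@ge0_continuous_FTC2y _ _ F 0 0).
- rewrite sub0e -EFinN; congr (_%:E).
  by rewrite /F /P /c !mulr0 expR0 sin0 cos0; field; rewrite enz eunz.
- move=> t _; rewrite mulr_ge0 ?expR_ge0//.
  exact: addr_mul_cos_ge0.
- exact: continuous_subspaceT.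
- apply/cvgrPdist_le => d d0.
  (* A bound of |P t| uniform in t; the summand 1 makes it positive, so that d / M is an admissible
     tolerance. *)
  pose M := `|a / e| + `|c| * (`|u| + `|e|) + 1.
  have M0 : 0 < M by rewrite ltr_wpDl// addr_ge0// mulr_ge0// addr_ge0.
  have : expR (- e * t) @[t --> +oo] --> (0 : R).
    rewrite (_ : (fun x => expR (- e * x)) = (fun z => expR (- z)) \o (fun z => e * z)).
      by apply: (@cvg_comp _ _ _ _ _ _ (pinfty_nbhs R)); [exact: gt0_cvgMry|exact: cvgr_expR].
    by apply/funext => x /=; rewrite mulNr.
  move=> /cvgrPdist_le/(_ (d / M)); rewrite divr_gt0// => /(_ isT).
  apply: filterS => t; rewrite !sub0r !normrN ger0_norm ?expR_ge0// => ht.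
  rewrite /F normrM ger0_norm ?expR_ge0//.
  rewrite -(divfK (lt0r_neq0 M0) d) ler_pM ?expR_ge0//.
  rewrite /P (le_trans (ler_normD _ _))// normrN /M -addrA lerD2l.
  rewrite ler_wpDr// normrM ler_wpM2l// (le_trans (ler_normB _ _))// !normrM.
  by rewrite lerD// ler_piMr// ler_norml ?sin_geN1 ?sin_le1 ?cos_geN1 ?cos_le1.
- by move=> t _; apply: ex_derive.
- by apply: cvg_at_right_filter; exact: (is_derive_continuous (dF 0)).
- by move=> t _; rewrite derive1E derive_val.
Qed.

(** The Fourier transform of exp (- e |t|), that is, 2 pi times the Cauchy density of scale e. *)
Definition cauchy_kernel (e u : R) : R := 2 * e / (e ^+ 2 + u ^+ 2).

(** Adding the values at t and - t cancels the sine part of cos (phi + u t) and leaves 2 cos phi cos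
    (u t). The value [cauchy_kernel e 0] is 2 / e, the mass of exp (- e |t|). *)
Lemma integral_abel_kernel (e u phi a b : R) : 0 < e -> `|b| <= a ->
  (\int[mu]_t (expR (- e * `|t|) * (a + b * cos (phi + u * t)))%:E =
   (a * cauchy_kernel e 0 + b * cos phi * cauchy_kernel e u)%:E)%E.
Proof.
move=> e0 ba.
have pos x := addr_mul_cos_ge0 x ba.
have mcosu : measurable_fun setT (fun t : R => cos (phi + u * t)).
  apply: (measurableT_comp (continuous_measurable_fun (@continuous_cos R))).
  by apply: measurable_funD => //; exact: measurable_funM.
rewrite ge0_integral_reflect; first last.
- apply/measurable_EFinP; apply: measurable_funM.
    apply: (measurableT_comp (continuous_measurable_fun (@continuous_expR R))).
    by apply: measurable_funM => //; exact: measurableT_comp.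
  by apply: measurable_funD => //; exact: measurable_funM.
- by move=> t; rewrite lee_fin mulr_ge0 ?expR_ge0.
have ba2 : `|2 * (b * cos phi)| <= 2 * a by rewrite normrM ger0_norm// ler_pM2l// normM_cos_le.
transitivity (\int[mu]_(t in `[0%R, +oo[)
    (expR (- e * t) * (2 * a + 2 * (b * cos phi) * cos (u * t)))%:E)%E.
  apply: eq_integral => t; rewrite inE/= in_itv/= andbT => t0.
  rewrite -EFinD normrN ger0_norm// mulrN !cosD cosN sinN; congr (_%:E); ring.
rewrite integral0y_expR_cos//; congr (_%:E); rewrite /cauchy_kernel.
have eu0 : 0 < e ^+ 2 + u ^+ 2 by rewrite ltr_wpDr ?sqr_ge0// exprn_gt0.
have enz : e != 0 by rewrite gt_eqF.
have eunz : e ^+ 2 + u ^+ 2 != 0 by rewrite gt_eqF.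
by rewrite expr0n/= addr0; field; rewrite enz eunz.
Qed.

Lemma integral_cauchy_kernel1 : (\int[mu]_t (cauchy_kernel 1 t)%:E = (2 * pi)%:E)%E.
Proof.
have ck t : cauchy_kernel 1 t = 2 * (1 + t ^+ 2)^-1.
  by rewrite /cauchy_kernel mulr1 expr1n.
have pos (t : R) : 0 < 1 + t ^+ 2 by rewrite ltr_wpDr ?sqr_ge0.
have cck : continuous (cauchy_kernel 1).
  move=> t; rewrite (_ : cauchy_kernel 1 = fun t => 2 * (1 + t ^+ 2)^-1); last exact/funext.
  apply: cvgMr; apply: cvgV; first by rewrite gt_eqF.
  by apply: cvgD; [exact: cvg_cst|exact: exprn_continuous].
rewrite ge0_symfun_integralT//; last 2 first.
- by move=> t; rewrite ck mulr_ge0// invr_ge0 ltW.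
- by move=> t /=; rewrite !ck sqrrN.
rewrite (_ : [set x | _] = `[0%R, +oo[%classic); last by rewrite set_itvcy.
have dF (t : R) : is_derive t 1 (fun t => 2 * atan t) (2 * (1 + t ^+ 2)^-1).
  exact: (is_deriveZ 2 (is_derive1_atan t)).
rewrite (@ge0_continuous_FTC2y _ _ (fun t => 2 * atan t) 0 (2 * (pi / 2))).
- by rewrite atan0 mulr0 -EFinB -EFinM subr0; congr (_%:E); field.
- by move=> t _; rewrite ck mulr_ge0// invr_ge0 ltW.
- exact: continuous_subspaceT.
- by apply: cvgMr; exact: cvgy_atan.
- by move=> t _; apply: ex_derive.
- by apply: cvgMr; apply: cvg_at_right_filter; exact: continuous_atan.
- by move=> t _; rewrite ck derive1E derive_val.
Qed.

End abel_kernel_1d.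

Section abel_kernel_rV.
Context {R : realType}.
Notation mu := (@lebesgue_measure R).
Implicit Type n : nat.

Definition norm1 n (y : 'rV[R]_n) : R := \sum_i `|y ord0 i|.

Definition cauchy_prod n (e : R) (u : 'rV[R]_n) : R :=
  \prod_i cauchy_kernel e (u ord0 i).

Lemma cons_rV0E n (t : R) (y : 'rV[R]_n) : cons_rV (t, y) ord0 ord0 = t.
Proof.
by rewrite /cons_rV/= mxE; case: splitP => // j _; rewrite mxE [j]ord1 eqxx mulr1n.
Qed.

Lemma cons_rVSE n (t : R) (y : 'rV[R]_n) i :
  cons_rV (t, y) ord0 (lift ord0 i) = y ord0 i.
Proof.
rewrite /cons_rV/= mxE; case: splitP => [j|j]; first by rewrite [j]ord1.
by rewrite /= /bump leq0n add1n => -[ij]; congr (y _ _); apply/val_inj.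
Qed.

Lemma dotp_cons n (t s : R) (y z : 'rV[R]_n) :
  dotp (cons_rV (t, y)) (cons_rV (s, z)) = t * s + dotp y z.
Proof.
rewrite /dotp big_ord_recl !cons_rV0E; congr (_ + _).
by apply: eq_bigr => i _; rewrite !cons_rVSE.
Qed.

Lemma norm1_cons n (t : R) (y : 'rV[R]_n) :
  norm1 (cons_rV (t, y)) = `|t| + norm1 y.
Proof.
rewrite /norm1 big_ord_recl !cons_rV0E; congr (_ + _).
by apply: eq_bigr => i _; rewrite !cons_rVSE.
Qed.

Lemma cauchy_prod_cons n (e t : R) (y : 'rV[R]_n) :
  cauchy_prod e (cons_rV (t, y)) = cauchy_kernel e t * cauchy_prod e y.
Proof.
rewrite /cauchy_prod big_ord_recl !cons_rV0E; congr (_ * _).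
by apply: eq_bigr => i _; rewrite !cons_rVSE.
Qed.

Lemma cons_rV0 n : cons_rV (0, 0) = 0 :> 'rV[R]_n.+1.
Proof.
rewrite -[RHS]cons_rV_uncons mxE; congr (cons_rV (_, _)).
by apply/rowP => i; rewrite !mxE.
Qed.

Lemma norm1_ge0 n (y : 'rV[R]_n) : 0 <= norm1 y.
Proof. exact: sumr_ge0. Qed.

Lemma cauchy_kernel_ge0 (e t : R) : 0 < e -> 0 <= cauchy_kernel e t.
Proof.
by move=> e0; rewrite divr_ge0 ?mulr_ge0 ?addr_ge0 ?sqr_ge0// ltW.
Qed.

Lemma cauchy_kernel_le0 (e t : R) : 0 < e -> cauchy_kernel e t <= cauchy_kernel e 0.
Proof.
move=> e0; rewrite ler_pM2l ?mulr_gt0// lef_pV2 ?posrE.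
- by rewrite expr0n/= addr0 lerDl sqr_ge0.
- by rewrite ltr_wpDr ?sqr_ge0// exprn_gt0.
- by rewrite expr0n/= addr0 exprn_gt0.
Qed.

Lemma cauchy_prod_ge0 n (e : R) (y : 'rV[R]_n) : 0 < e -> 0 <= cauchy_prod e y.
Proof. by move=> e0; apply: prodr_ge0 => i _; exact: cauchy_kernel_ge0. Qed.

(** Supplies the bound |b| <= a of [integral_abel_kernel] at each step of the induction on the
    dimension. *)
Lemma cauchy_prod_le0 n (e : R) (y : 'rV[R]_n) :
  0 < e -> cauchy_prod e y <= cauchy_prod e (0 : 'rV_n).
Proof.
move=> e0; apply: ler_prod => i _.
by rewrite cauchy_kernel_ge0// mxE cauchy_kernel_le0.
Qed.

Lemma measurable_dotp d (T : measurableType d) n (f g : T -> 'rV[R]_n) :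
  measurable_fun setT f -> measurable_fun setT g ->
  measurable_fun setT (fun x => dotp (f x) (g x)).
Proof.
move=> mf mg; apply: measurable_sum => i; apply: measurable_funM.
  exact: measurableT_comp (measurable_coord i) mf.
exact: measurableT_comp (measurable_coord i) mg.
Qed.

Lemma measurable_norm1 n : measurable_fun setT (@norm1 n).
Proof.
apply: measurable_sum => i; apply: measurableT_comp => //.
exact: measurable_coord.
Qed.

Lemma measurable_cos_comp d (T : measurableType d) (f : T -> R) :
  measurable_fun setT f -> measurable_fun setT (fun x => cos (f x)).
Proof. exact: (measurableT_comp (continuous_measurable_fun (@continuous_cos R))). Qed.

Lemma measurable_sin_comp d (T : measurableType d) (f : T -> R) :
  measurable_fun setT f -> measurable_fun setT (fun x => sin (f x)).
Proof. exact: (measurableT_comp (continuous_measurable_fun (@continuous_sin R))). Qed.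

Lemma measurable_expR_comp d (T : measurableType d) (f : T -> R) :
  measurable_fun setT f -> measurable_fun setT (fun x => expR (f x)).
Proof. exact: (measurableT_comp (continuous_measurable_fun (@continuous_expR R))). Qed.

Lemma measurable_cauchy_prod n (e : R) : 0 < e -> measurable_fun setT (@cauchy_prod n e).
Proof.
move=> e0; apply: measurable_prod => i _.
have -> : (fun x : 'rV[R]_n => cauchy_kernel e (x ord0 i)) =
    cauchy_kernel e \o (fun x => x ord0 i) by [].
apply: measurableT_comp; last exact: measurable_coord.
apply: continuous_measurable_fun => t; apply: cvgMr; apply: cvgV.
  by rewrite gt_eqF// ltr_wpDr ?sqr_ge0// exprn_gt0.
by apply: cvgD; [exact: cvg_cst|exact: exprn_continuous].
Qed.

(* The phase phi is there for the induction on n: it absorbs the coordinates not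
   yet integrated. *)
Lemma integral_abel_kernel_rV n (e phi : R) (u : 'rV[R]_n) : 0 < e ->
  (\int[@lebesgue_rV R n]_y
     (expR (- e * norm1 y) * (1 + cos (phi + dotp u y)))%:E =
   (cauchy_prod e (0 : 'rV_n) + cos phi * cauchy_prod e u)%:E)%E.
Proof.
move=> e0; have c1 x : 0 <= 1 + cos x :> R.
  by have := @cos_geN1 R x; lra.
elim: n phi u => [phi u|n IH phi u].
  rewrite /= integral_dirac//=; last first.
    apply/measurable_EFinP; apply: measurable_funM.
      by apply: measurable_expR_comp; apply: measurable_funM => //; exact: measurable_norm1.
    apply: measurable_funD => //; apply: measurable_cos_comp.
    by apply: measurable_funD => //; exact: measurable_dotp.
  rewrite diracT mul1e /norm1 /dotp /cauchy_prod !big_ord0.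
  by rewrite mulr0 expR0 mul1r addr0 mulr1.
rewrite -[u]cons_rV_uncons; set u0 := u ord0 ord0; set u' := \row_i _.
rewrite ge0_integral_rVS; first last.
- by move=> y; rewrite lee_fin mulr_ge0 ?expR_ge0.
- apply/measurable_EFinP; apply: measurable_funM.
    by apply: measurable_expR_comp; apply: measurable_funM => //; exact: measurable_norm1.
  apply: measurable_funD => //; apply: measurable_cos_comp.
  by apply: measurable_funD => //; exact: measurable_dotp.
transitivity (\int[mu]_t (expR (- e * `|t|) * (cauchy_prod e (0 : 'rV[R]_n) +
    cauchy_prod e u' * cos (phi + u0 * t)))%:E)%E.
  apply: eq_integral => t _; rewrite [in RHS]mulrC -[in RHS](mulrC (cos _)).
  rewrite mulrC EFinM -IH -ge0_integralZl//; last first.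
    apply/measurable_EFinP; apply: measurable_funM.
      by apply: measurable_expR_comp; apply: measurable_funM => //; exact: measurable_norm1.
    apply: measurable_funD => //; apply: measurable_cos_comp.
    by apply: measurable_funD => //; exact: measurable_dotp.
  apply: eq_integral => y _; rewrite norm1_cons dotp_cons [(- e) * (_ + _)]mulrDr expRD addrA.
  by rewrite -mulrA EFinM.
rewrite integral_abel_kernel//; last by rewrite ger0_norm ?cauchy_prod_ge0// cauchy_prod_le0.
rewrite -cons_rV0 !cauchy_prod_cons; congr (_%:E); ring.
Qed.

Lemma integral_cauchy_prod1 n :
  (\int[@lebesgue_rV R n]_z (cauchy_prod 1 z)%:E = ((2 * pi) ^+ n)%:E)%E.
Proof.
elim: n => [|n IH].
  rewrite /= integral_dirac//=; last by apply/measurable_EFinP; exact: measurable_cauchy_prod.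
  by rewrite diracT mul1e /cauchy_prod big_ord0 expr0.
rewrite ge0_integral_rVS; first last.
- by move=> y; rewrite lee_fin cauchy_prod_ge0.
- by apply/measurable_EFinP; exact: measurable_cauchy_prod.
transitivity (\int[mu]_t (((2 * pi) ^+ n)%:E * (cauchy_kernel 1 t)%:E))%E.
  apply: eq_integral => t _; rewrite -IH muleC -ge0_integralZl//; last 3 first.
  - by apply/measurable_EFinP; exact: measurable_cauchy_prod.
  - by move=> y _; rewrite lee_fin cauchy_prod_ge0.
  - by rewrite lee_fin cauchy_kernel_ge0.
  by apply: eq_integral => y _; rewrite cauchy_prod_cons EFinM.
rewrite ge0_integralZl//; last 3 first.
- apply/measurable_EFinP; apply: continuous_measurable_fun => t; apply: cvgMr; apply: cvgV.
    by rewrite gt_eqF// ltr_wpDr ?sqr_ge0// exprn_gt0.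
  by apply: cvgD; [exact: cvg_cst|exact: exprn_continuous].
- by move=> t _; rewrite lee_fin cauchy_kernel_ge0.
- by rewrite lee_fin exprn_ge0// mulr_ge0// pi_ge0.
by rewrite integral_cauchy_kernel1 -EFinM exprSr.
Qed.

(** The factor e^n is the Jacobian of u = e z, which therefore turns the kernel of scale e into that
    of scale 1. *)
Lemma cauchy_prod_scale n (e : R) (z : 'rV[R]_n) : 0 < e ->
  e ^+ n * cauchy_prod e (e *: z) = cauchy_prod 1 z.
Proof.
move=> e0; have -> : e ^+ n = \prod_(i < n) e by rewrite prodr_const card_ord.
rewrite -big_split/=.
apply: eq_bigr => i _; rewrite mxE /cauchy_kernel.
have h : 1 + z ord0 i ^+ 2 != 0 by rewrite gt_eqF// ltr_wpDr ?sqr_ge0.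
have h' : e ^+ 2 + (e * z ord0 i) ^+ 2 != 0.
  by rewrite exprMn -[X in X + _]mulr1 -mulrDr mulf_neq0// expf_neq0// gt_eqF.
by field; rewrite h' h.
Qed.

End abel_kernel_rV.

(** * Plancherel's formula *)

Section power_spectrum.
Context {R : realType} (n : nat).
Notation mu := (@lebesgue_rV R n).
Implicit Types (K : set 'rV[R]_n) (x y u : 'rV[R]_n).

Definition power_spectrum K y : R :=
  ComplexField.Normc.normc (fourier (charfun K) y) ^+ 2.

Lemma power_spectrum_ge0 K y : 0 <= power_spectrum K y.
Proof. exact: sqr_ge0. Qed.

Definition autocorrelation K u : \bar R :=
  (\int[mu]_x (\1_K x * \1_K (x + u))%:E)%E.

Lemma autocorrelation_ge0 K u : (0 <= autocorrelation K u)%E.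
Proof. by apply: integral_ge0 => x _; rewrite lee_fin mulr_ge0. Qed.

Lemma power_spectrumE K y : power_spectrum K y =
  (\int[mu]_x (\1_K x * cos (- dotp x y)))%R ^+ 2 +
  (\int[mu]_x (\1_K x * sin (- dotp x y)))%R ^+ 2.
Proof.
rewrite /power_spectrum /fourier /cintegral /ComplexField.Normc.normc.
rewrite sqr_sqrtr ?addr_ge0 ?sqr_ge0//.
congr (_ ^+ 2 + _ ^+ 2); congr fine; apply: eq_integral => x _;
  rewrite /expi /charfun /= mulr0 ?subr0 ?add0r mulrC//.
Qed.

Context (K : set 'rV[R]_n) (V : R).
Hypotheses (mK : measurable K) (KV : lebesgue_rV K = V%:E).

Let V0 : 0 <= V. Proof. by rewrite -lee_fin -KV. Qed.

Let intK : (\int[mu]_x (\1_K x)%:E = V%:E)%E.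
Proof. by rewrite integral_indic// setIT. Qed.

Let integrable_indicM (g : 'rV[R]_n -> R) : measurable_fun setT g ->
  (forall x, `|g x| <= 1) -> mu.-integrable setT (fun x => (\1_K x * g x)%:E).
Proof.
move=> mg g1; apply: (@le_integrable _ _ _ _ _ _ _ (fun x => (\1_K x)%:E)) => //.
- by apply/measurable_EFinP; apply: measurable_funM => //; exact: measurable_indic.
- by move=> x _; rewrite /= lee_fin normrM ler_piMr.
- apply/integrableP; split; first by apply/measurable_EFinP; exact: measurable_indic.
  under eq_integral do rewrite gee0_abs ?lee_fin//.
  by rewrite intK ltry.
Qed.

(** Passes from the signed real integrals that define the Fourier transform to extended-real ones,
    on which Tonelli's theorem acts. Finite volume of K makes the bounded factors integrable. *)
Let integral_indic_lin (c s : 'rV[R]_n -> R) (a b d : R) :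
  measurable_fun setT c -> measurable_fun setT s ->
  (forall x, `|c x| <= 1) -> (forall x, `|s x| <= 1) ->
  (\int[mu]_x (\1_K x * (a + b * c x + d * s x))%:E =
   (a * V + b * (\int[mu]_x (\1_K x * c x))%R +
    d * (\int[mu]_x (\1_K x * s x))%R)%:E)%E.
Proof.
move=> mc ms c1 s1.
have ic := integrable_indicM mc c1; have is' := integrable_indicM ms s1.
have i1 : mu.-integrable setT (fun x => (\1_K x)%:E).
  have := @integrable_indicM (cst 1) (@measurable_cst _ _ _ _ _ _) _.
  rewrite /cst normr1 => /(_ (fun _ => lexx _)).
  by under eq_fun do rewrite mulr1.
transitivity (\int[mu]_x ((a%:E * (\1_K x)%:E + b%:E * (\1_K x * c x)%:E) +
    d%:E * (\1_K x * s x)%:E))%E.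
  by apply: eq_integral => x _; rewrite -!EFinM -!EFinD; congr (_%:E); ring.
rewrite integralD//; last 2 first.
- by apply: integrableD => //; exact: integrableZl.
- exact: integrableZl.
rewrite integralD//; [|exact: integrableZl|exact: integrableZl].
rewrite !integralZl// intK !EFinD !EFinM; congr (_ + _ * _ + _ * _)%E.
  by rewrite fineK//; exact: integrable_fin_num.
by rewrite fineK//; exact: integrable_fin_num.
Qed.

Lemma measurable_autocorrelation_fun :
  measurable_fun setT (fun z : 'rV[R]_n * 'rV[R]_n => (\1_K z.2 * \1_K (z.2 + z.1) : R)%:E).
Proof.
apply/measurable_EFinP; apply: measurable_funM; apply: measurable_indic_comp => //.
exact: measurable_add_rV.
Qed.

Lemma measurable_autocorrelation : measurable_fun setT (autocorrelation K).
Proof.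
apply: (@measurable_fun_fubini_tonelli_F _ _ _ _ R mu _ measurable_autocorrelation_fun).
by move=> z; rewrite lee_fin mulr_ge0.
Qed.

(** After Tonelli's theorem, the substitution x' = x + u at fixed x turns the weight on the
    displacement u into a weight on pairs of points of K. *)
Lemma integral_autocorrelation (g : 'rV[R]_n -> R) :
  measurable_fun setT g -> (forall x, 0 <= g x) ->
  (\int[mu]_u (autocorrelation K u * (g u)%:E) =
   \int[mu]_x \int[mu]_x' (\1_K x * \1_K x' * g (x' - x)%R)%:E)%E.
Proof.
move=> mg g0.
pose G (z : 'rV[R]_n * 'rV[R]_n) := (\1_K z.2 * \1_K (z.2 + z.1) * g z.1)%:E.
have mG : measurable_fun setT G.
  apply/measurable_EFinP; apply: measurable_funM.
    by have /measurable_EFinP := measurable_autocorrelation_fun.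
  exact: measurableT_comp.
have G0 z : (0 <= G z)%E by rewrite lee_fin !mulr_ge0.
transitivity (\int[mu]_u \int[mu]_x G (u, x))%E.
  apply: eq_integral => u _; rewrite muleC -ge0_integralZl//.
  - by apply: eq_integral => x _; rewrite -EFinM mulrC.
  - exact: measurableT_comp measurable_autocorrelation_fun (pair1_measurable _).
  - by rewrite lee_fin.
apply: etrans (@fubini_tonelli _ _ _ _ R mu mu G mG G0) _.
apply: eq_integral => x _.
pose H x' := (\1_K x * \1_K x' * g (x' - x)%R)%:E.
rewrite -(@ge0_integral_rV_shift _ _ x H).
- by apply: eq_integral => u _; rewrite /G /H/= addrK addrC.
- apply/measurable_EFinP; apply: measurable_funM.
    by apply: measurable_funM => //; exact: measurable_indic.
  exact: (measurableT_comp mg (@measurable_addr_rV R n (- x))).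
- by move=> x'; rewrite lee_fin !mulr_ge0.
Qed.

Lemma integral_autocorrelation1 : (\int[mu]_u autocorrelation K u = (V ^+ 2)%:E)%E.
Proof.
transitivity (\int[mu]_u (autocorrelation K u * (1%R)%:E))%E.
  by apply: eq_integral => u _; rewrite mule1.
rewrite (integral_autocorrelation (g := cst 1))//.
transitivity (\int[mu]_x (V%:E * (\1_K x)%:E))%E.
  apply: eq_integral => x _; rewrite -intK muleC -ge0_integralZl//.
  - by apply: eq_integral => x' _; rewrite mulr1 EFinM.
  - by apply/measurable_EFinP; exact: measurable_indic.
rewrite ge0_integralZl// ?intK//.
by apply/measurable_EFinP; exact: measurable_indic.
Qed.

Lemma dotpBl x x' y : dotp (x' - x) y = dotp x' y - dotp x y.
Proof. by rewrite /dotp -sumrB; apply: eq_bigr => i _; rewrite !mxE mulrBl. Qed.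

(* Adding V^2 turns cos into 1 + cos >= 0, so that only Tonelli's theorem is
   needed here and in the consequences. *)
Lemma power_spectrum_autocorrelation y :
  ((V ^+ 2 + power_spectrum K y)%:E =
   \int[mu]_u (autocorrelation K u * (1 + cos (dotp u y))%:E))%E.
Proof.
have md : measurable_fun setT (fun x => dotp x y) by exact: measurable_dotp.
have mc : measurable_fun setT (fun x => cos (- dotp x y)).
  by apply: measurable_cos_comp; exact: measurableT_comp.
have ms : measurable_fun setT (fun x => sin (- dotp x y)).
  by apply: measurable_sin_comp; exact: measurableT_comp.
have c1 (x : 'rV[R]_n) : `|cos (- dotp x y)| <= 1.
  by rewrite ler_norml cos_geN1 cos_le1.
have s1 (x : 'rV[R]_n) : `|sin (- dotp x y)| <= 1.
  by rewrite ler_norml sin_geN1 sin_le1.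
rewrite integral_autocorrelation; first last.
- by move=> x; have := @cos_geN1 R (dotp x y); lra.
- by apply: measurable_funD => //; exact: measurable_cos_comp.
rewrite power_spectrumE; set C := (\int[_]_x (_ * cos _))%R; set S := (\int[_]_x (_ * sin _))%R.
(* In V V + C C + S S one factor of each product is opened as an integral over x, the other as an
   integral over x'. The addition formula then gives 1 + cos of the difference of phases. *)
transitivity (\int[mu]_x (\1_K x * (V + C * cos (- dotp x y) + S * sin (- dotp x y)))%:E)%E.
  by rewrite integral_indic_lin// -/C -/S; congr (_%:E); ring.
apply: eq_integral => x _.
transitivity (\int[mu]_x' (\1_K x' * (\1_K x + \1_K x * cos (- dotp x y) * cos (- dotp x' y)
   + \1_K x * sin (- dotp x y) * sin (- dotp x' y)))%:E)%E.
  by rewrite integral_indic_lin// -/C -/S; congr (_%:E); ring.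
apply: eq_integral => x' _; congr (_%:E).
rewrite dotpBl -[_ - dotp x y]opprK opprB cosN opprD opprK cosD.
by rewrite !cosN !sinN; ring.
Qed.

End power_spectrum.

Section plancherel.
Context {R : realType} (n : nat).
Notation mu := (@lebesgue_rV R n).
Implicit Types (x y u z : 'rV[R]_n).
Context (K : set 'rV[R]_n) (V : R).
Hypotheses (mK : measurable K) (KV : lebesgue_rV K = V%:E).

Let V0 : 0 <= V. Proof. by rewrite -lee_fin -KV. Qed.

Let cos1 (x : R) : 0 <= 1 + cos x.
Proof. by have := @cos_geN1 R x; lra. Qed.

Let measurable_acos : measurable_fun setT (fun z : 'rV[R]_n * 'rV[R]_n =>
  (autocorrelation K z.1 * (1 + cos (dotp z.1 z.2))%:E)%E).
Proof.
apply: emeasurable_funM.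
  by apply: measurableT_comp => //; exact: measurable_autocorrelation.
apply/measurable_EFinP; apply: measurable_funD => //.
by apply: measurable_cos_comp; exact: measurable_dotp.
Qed.

Let acos_ge0 (z : 'rV[R]_n * 'rV[R]_n) :
  (0 <= autocorrelation K z.1 * (1 + cos (dotp z.1 z.2))%:E)%E.
Proof. by rewrite mule_ge0 ?autocorrelation_ge0 ?lee_fin. Qed.

(** Up to the constant V^2 the power spectrum is a parametric integral of a nonnegative function
    measurable in both variables. *)
Lemma measurable_power_spectrum : measurable_fun setT (power_spectrum K).
Proof.
have m : measurable_fun setT (fun y => (V ^+ 2 + power_spectrum K y)%:E).
  under eq_fun do rewrite (power_spectrum_autocorrelation mK KV).
  exact: (@measurable_fun_fubini_tonelli_G _ _ _ _ R mu _ measurable_acos acos_ge0).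
have -> : power_spectrum K = (fun y => (V ^+ 2 + power_spectrum K y) - V ^+ 2).
  by apply/funext => y; rewrite addrAC subrr add0r.
by apply: measurable_funB => //; exact/measurable_EFinP.
Qed.

(** From 1 + cos <= 2 and the mass V^2 of the autocorrelation, V^2 plus the power spectrum is at
    most 2 V^2. *)
Lemma power_spectrum_le y : power_spectrum K y <= V ^+ 2.
Proof.
rewrite -(lerD2l (V ^+ 2)) -lee_fin (power_spectrum_autocorrelation mK KV).
apply: (@le_trans _ _ (\int[mu]_u (2%:E * autocorrelation K u))%E).
  apply: ge0_le_integral => //.
  - by move=> u _; exact: (acos_ge0 (u, y)).
  - exact: (measurableT_comp measurable_acos (pair2_measurable y)).
  - by apply: measurable_funeM; exact: measurable_autocorrelation.
  - move=> u _; rewrite muleC lee_wpmul2r ?autocorrelation_ge0// lee_fin.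
    by have := @cos_le1 R (dotp u y); lra.
rewrite ge0_integralZl//; last 2 first.
- exact: measurable_autocorrelation.
- by move=> u _; exact: autocorrelation_ge0.
by rewrite (integral_autocorrelation1 mK KV) -EFinM lee_fin; lra.
Qed.

Let mabel (e : R) : measurable_fun setT (fun y => expR (- e * norm1 y)).
Proof.
by apply: measurable_expR_comp; apply: measurable_funM => //; exact: measurable_norm1.
Qed.

(** The double integral of the Abel kernel times A(u) (1 + cos (u.y)) is computed in both orders. *)
Lemma integral_abel_power_spectrum (e : R) : 0 < e ->
  (\int[mu]_y (expR (- e * norm1 y) * power_spectrum K y)%:E =
   \int[mu]_u (autocorrelation K u * (cauchy_prod e u)%:E))%E.
Proof.
move=> e0.
pose q0 : R := cauchy_prod e (0 : 'rV[R]_n).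
have mA := measurable_autocorrelation mK.
have mS := measurable_power_spectrum.
have mQ : measurable_fun setT (fun u => (autocorrelation K u * (cauchy_prod e u)%:E)%E).
  by apply: emeasurable_funM => //; apply/measurable_EFinP; exact: measurable_cauchy_prod.
have q00 : 0 <= q0 by exact: cauchy_prod_ge0.
(* At phase 0 and u = 0 the factor 1 + cos is constantly 2, so the kernel lemma gives twice this
   value. *)
have intk : (\int[mu]_y (expR (- e * norm1 y))%:E = q0%:E)%E.
  have := integral_abel_kernel_rV 0 (0 : 'rV[R]_n) e0.
  rewrite cos0 mul1r -/q0 => h.
  have : (2%:E * \int[mu]_y (expR (- e * norm1 y))%:E = 2%:E * q0%:E)%E.
    rewrite -EFinM (_ : 2 * q0 = q0 + q0); last by ring.
    rewrite -h -ge0_integralZl//; last by apply/measurable_EFinP.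
    apply: eq_integral => y _; rewrite -EFinM /dotp big1 ?addr0 ?cos0; last first.
      by move=> i _; rewrite mxE mul0r.
    by congr (_%:E); ring.
  by move/(congr1 (fun t : \bar R => (2^-1)%:E * t)%E); rewrite !muleA -EFinM mulVf// !mul1e.
(* The 1 in 1 + cos contributes the same finite amount to both sides: V^2 times the mass q0 of the
   kernel, and q0 times the mass V^2 of the autocorrelation. *)
have : ((q0 * V ^+ 2)%:E + \int[mu]_y (expR (- e * norm1 y) * power_spectrum K y)%:E =
  (q0 * V ^+ 2)%:E + \int[mu]_u (autocorrelation K u * (cauchy_prod e u)%:E))%E.
  transitivity (\int[mu]_y \int[mu]_u
     ((expR (- e * norm1 y))%:E * (autocorrelation K u * (1 + cos (dotp u y))%:E)))%E.
    transitivity (\int[mu]_y ((V ^+ 2)%:E * (expR (- e * norm1 y))%:E +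
        (expR (- e * norm1 y) * power_spectrum K y)%:E))%E.
      rewrite ge0_integralD//.
      - rewrite ge0_integralZl//; first by rewrite intk mulrC EFinM.
        + by apply/measurable_EFinP.
        + by rewrite lee_fin sqr_ge0.
      - by move=> y _; rewrite mule_ge0// lee_fin sqr_ge0.
      - by apply: measurable_funeM; apply/measurable_EFinP.
      - by move=> y _; rewrite lee_fin mulr_ge0 ?expR_ge0 ?power_spectrum_ge0.
      - by apply/measurable_EFinP; exact: measurable_funM.
    apply: eq_integral => y _; rewrite ge0_integralZl//.
    - rewrite -(power_spectrum_autocorrelation mK KV) -!EFinM -EFinD.
      by congr (_%:E); ring.
    - exact: (measurableT_comp measurable_acos (pair2_measurable y)).
    - by move=> u _; exact: (acos_ge0 (u, y)).
  pose G (z : 'rV[R]_n * 'rV[R]_n) := ((expR (- e * norm1 z.1))%:E *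
    (autocorrelation K z.2 * (1 + cos (dotp z.2 z.1))%:E))%E.
  have mG : measurable_fun setT G.
    apply: emeasurable_funM.
      by apply/measurable_EFinP; exact: (measurableT_comp (mabel e) measurable_fst).
    have msw : measurable_fun setT (fun z : 'rV[R]_n * 'rV[R]_n => (z.2, z.1)).
      exact: measurable_fun_pair.
    exact: (measurableT_comp measurable_acos msw).
  have G0 (z : 'rV[R]_n * 'rV[R]_n) : (0 <= G z)%E.
    by rewrite mule_ge0 ?lee_fin ?expR_ge0//; exact: (acos_ge0 (z.2, z.1)).
  apply: etrans (@fubini_tonelli _ _ _ _ R mu mu G mG G0) _.
  transitivity (\int[mu]_u (q0%:E * autocorrelation K u +
      autocorrelation K u * (cauchy_prod e u)%:E))%E.
    apply: eq_integral => u _.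
    rewrite [X in (X + _)%E]muleC -ge0_muleDr ?lee_fin ?cauchy_prod_ge0//.
    rewrite -EFinD -[X in q0 + X]mul1r -(cos0 R) /q0 -(integral_abel_kernel_rV 0 u e0).
    rewrite -ge0_integralZl//; last 2 first.
    - apply/measurable_EFinP; apply: measurable_funM => //.
      apply: measurable_funD => //; apply: measurable_cos_comp.
      by apply: measurable_funD => //; exact: measurable_dotp.
    - exact: autocorrelation_ge0.
    by apply: eq_integral => y _; rewrite /G/= add0r EFinM muleCA.
  rewrite ge0_integralD//.
  - rewrite ge0_integralZl//; first by rewrite (integral_autocorrelation1 mK KV) -EFinM.
    by move=> u _; exact: autocorrelation_ge0.
  - by move=> u _; rewrite mule_ge0 ?lee_fin ?autocorrelation_ge0.
  - exact: measurable_funeM.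
  - by move=> u _; rewrite mule_ge0 ?lee_fin ?autocorrelation_ge0 ?cauchy_prod_ge0.
move/(congr1 (fun t : \bar R => t - (q0 * V ^+ 2)%:E)%E).
by rewrite ![((q0 * V ^+ 2)%:E + _)%E]addeC !addeK.
Qed.

(** With u = e z the weight no longer depends on e, so monotonicity and the limit as e decreases to
    0 concern the autocorrelation alone. *)
Lemma integral_abel_power_spectrum_scale (e : R) : 0 < e ->
  (\int[mu]_y (expR (- e * norm1 y) * power_spectrum K y)%:E =
   \int[mu]_z (autocorrelation K (e *: z) * (cauchy_prod 1 z)%:E))%E.
Proof.
move=> e0; rewrite (integral_abel_power_spectrum e0).
have mQ : measurable_fun setT (fun u => (autocorrelation K u * (cauchy_prod e u)%:E)%E).
  apply: emeasurable_funM; first exact: measurable_autocorrelation.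
  by apply/measurable_EFinP; exact: measurable_cauchy_prod.
have Q0 u : (0 <= autocorrelation K u * (cauchy_prod e u)%:E)%E.
  by rewrite mule_ge0 ?autocorrelation_ge0 ?lee_fin ?cauchy_prod_ge0.
have mse : measurable_fun setT (fun z => e *: z : 'rV[R]_n).
  exact: measurable_scale_rV.
have mQe := measurableT_comp mQ mse.
rewrite (ge0_integral_rV_scale (c := e))// ?gt_eqF// -ge0_integralZl//.
apply: eq_integral => z _; rewrite gtr0_norm// muleCA -EFinM.
by rewrite cauchy_prod_scale.
Qed.

Lemma plancherel_indicator :
  (forall z, nondecreasing_seq (fun k => autocorrelation K (k.+1%:R^-1 *: z))) ->
  (forall z, autocorrelation K (k.+1%:R^-1 *: z) @[k --> \oo] --> V%:E) ->
  (\int[mu]_y (power_spectrum K y)%:E = ((2 * pi) ^+ n * V)%:E)%E.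
Proof.
move=> ndA cA.
have mS := measurable_power_spectrum.
have mQ1 : measurable_fun setT (fun z => (@cauchy_prod R n 1 z)%:E).
  by apply/measurable_EFinP; exact: measurable_cauchy_prod.
have Q10 z : (0 <= (@cauchy_prod R n 1 z)%:E)%E by rewrite lee_fin cauchy_prod_ge0.
pose F k y := (expR (- k.+1%:R^-1 * norm1 y) * power_spectrum K y)%:E.
pose G k z := (autocorrelation K (k.+1%:R^-1 *: z) * (cauchy_prod 1 z)%:E)%E.
have FG : (fun k => \int[mu]_y F k y)%E = (fun k => \int[mu]_z G k z)%E.
  by apply/funext => k; exact: integral_abel_power_spectrum_scale.
have cF y : F k y @[k --> \oo] --> (power_spectrum K y)%:E.
  apply: cvg_EFin; first exact: nearW.
  rewrite -[X in _ --> X]mul1r; apply: cvgMl.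
  have h0 : - k.+1%:R^-1 * norm1 y @[k --> \oo] --> (0 : R).
    rewrite -(mul0r (norm1 y)); apply: cvgMl; rewrite -oppr0; apply: cvgN.
    exact: (@cvg_harmonic R).
  rewrite -[X in _ --> X]expR0.
  exact: (continuous_cvg _ (@continuous_expR R 0) h0).
have cG z : G k z @[k --> \oo] --> (V%:E * (cauchy_prod 1 z)%:E)%E.
  apply: cvgeZr => //; exact: cA.
have mF k : measurable_fun setT (F k).
  by apply/measurable_EFinP; exact: measurable_funM.
have F0 k y : setT y -> (0 <= F k y)%E.
  by move=> _; rewrite lee_fin mulr_ge0 ?expR_ge0 ?power_spectrum_ge0.
have leV (k l : nat) : (k <= l)%N -> l.+1%:R^-1 <= k.+1%:R^-1 :> R.
  by move=> kl; rewrite lef_pV2 ?posrE// ler_nat ltnS.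
have ndF y : setT y -> nondecreasing_seq (F^~ y).
  move=> _ k l kl; rewrite lee_fin ler_wpM2r ?power_spectrum_ge0// ler_expR.
  by rewrite ler_wpM2r ?norm1_ge0// lerN2 leV.
have mG k : measurable_fun setT (G k).
  apply: emeasurable_funM => //; apply: measurableT_comp.
    exact: measurable_autocorrelation.
  exact: measurable_scale_rV.
have G0 k z : setT z -> (0 <= G k z)%E by move=> _; rewrite mule_ge0 ?autocorrelation_ge0.
have ndG z : setT z -> nondecreasing_seq (G^~ z).
  by move=> _ k l kl; rewrite lee_wpmul2r// ndA.
have hF := monotone_convergence mu measurableT mF F0 ndF.
have hG := monotone_convergence mu measurableT mG G0 ndG.
transitivity (\int[mu]_x limn (F^~ x))%E.
  by apply: eq_integral => y _; apply/esym/cvg_lim => //; exact: cF.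
rewrite hF FG -hG.
transitivity (\int[mu]_z (V%:E * (cauchy_prod 1 z)%:E))%E.
  by apply: eq_integral => z _; apply/cvg_lim => //; exact: cG.
by rewrite ge0_integralZl// integral_cauchy_prod1 -EFinM mulrC.
Qed.

End plancherel.

(** * Volume and autocorrelation of a convex body *)

Section boxes.
Context {R : realType}.
Implicit Type n : nat.

(** A ball of the sup norm, the norm in which boundedness and interior are expressed; boxes bound
    the volume of a convex body from above and, after translation, from below. *)
Definition box n (M : R) : set 'rV[R]_n := [set x | forall i, `|x ord0 i| <= M].

Lemma measurable_box n M : measurable (@box n M).
Proof.
rewrite (_ : @box n M = \bigcap_(i in [set: 'I_n])
    (fun x : 'rV[R]_n => x ord0 i) @^-1` `[- M, M]); last first.
  apply/seteqP; split => x /= bx => [i _|i].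
    by rewrite /= in_itv/= -ler_norml; exact: bx.
  by rewrite ler_norml; have := bx i I; rewrite /= in_itv.
apply: fin_bigcap_measurable => // i _.
by rewrite -[X in measurable X]setTI; exact: measurable_coord.
Qed.

Lemma lebesgue_rV_box n M : 0 <= M -> lebesgue_rV (@box n M) = ((2 * M) ^+ n)%:E.
Proof.
move=> M0; elim: n => [|n IH].
  by rewrite /= diracE mem_set ?expr0// => -[].
rewrite [LHS](_ : _ = (lebesgue_measure \x @lebesgue_rV R n)%E
    (`[- M, M]%classic `*` box M)).
  rewrite product_measure1E//; last exact: measurable_box.
  rewrite [X in (X * _)%E](_ : _ = lebesgue_measure `[- M, M]%classic)//.
  rewrite lebesgue_measure_itv/= lte_fin IH.
  have [MM|] := ltP (- M) M.
    by rewrite -EFinD -EFinM exprS; congr (_%:E); ring.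
  move=> MM; have -> : M = 0 by lra.
  by rewrite mul0e mulr0 expr0n.
rewrite [LHS]/lebesgue_rV /pushforward; congr (product_measure1 _ _ _).
apply/seteqP; split => -[t y] /=; rewrite /box/= in_itv/= -ler_norml.
  move=> b; split; first by have := b ord0; rewrite cons_rV0E.
  by move=> i; have := b (lift ord0 i); rewrite cons_rVSE.
move=> [bt by'] i; have [j ->|->] := unliftP ord0 i; first by rewrite cons_rVSE.
by rewrite cons_rV0E.
Qed.

Lemma coord_le_norm1 n (z : 'rV[R]_n) i : `|z ord0 i| <= norm1 z.
Proof. by rewrite /norm1 (bigD1 i)//= lerDl sumr_ge0. Qed.

End boxes.

Section convex_body.
Context {R : realType} (n : nat).
Notation mu := (@lebesgue_rV R n).
Implicit Types (x y u z : 'rV[R]_n).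
Context (K : set 'rV[R]_n).
Hypothesis (cK : convex_body K).

Lemma convex_body_measurable : measurable K.
Proof.
have [kK _ _] := cK; rewrite -[K]setCK; apply: measurableC; apply: open_measurable_rV.
by rewrite openC; apply: compact_closed => //; exact: norm_hausdorff.
Qed.

Lemma convex_bodyP x y (t : R) : K x -> K y -> 0 <= t <= 1 ->
  K (t *: x + (1 - t) *: y).
Proof.
have [_ cvx _] := cK; move=> Kx Ky /andP[t0 t1].
by have := cvx x y (Itv01 t0 t1); rewrite !inE => /(_ Kx Ky).
Qed.

Lemma convex_body_ball : exists (c : 'rV[R]_n) (r : R), 0 < r /\
  forall h : 'rV[R]_n, (forall i, `|h ord0 i| < r) -> K (c + h).
Proof.
have [_ _ [c /nbhs_ballP[r /= r0 rK]]] := cK; exists c, r; split => // h hr.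
apply: rK; split => // i j; rewrite ord1 mxE /ball/= opprD addrA subrr sub0r normrN.
exact: hr.
Qed.

Lemma convex_body_vol_lty : (mu K < +oo)%E.
Proof.
have [kK _ _] := cK; have [M [Mr MK]] := compact_bounded kK.
pose N := Num.max (M + 1) 0.
have N0 : 0 <= N by rewrite le_max lexx orbT.
apply: (@le_lt_trans _ _ (mu (@box _ n N))); last by rewrite lebesgue_rV_box ?ltry.
apply: le_measure; rewrite ?inE; [exact: convex_body_measurable|exact: measurable_box|].
move=> v Kv i; apply: (@le_trans _ _ (M + 1)); last by rewrite le_max lexx.
apply: le_trans (MK _ _ _ Kv); last by rewrite ltrDl.
have /mapP[j Hj ->] : `|v ord0 i| \in [seq `|v x.1 x.2| | x : 'I_1 * 'I_n].
  by apply/mapP; exists (ord0, i) => //=; rewrite mem_enum.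
by rewrite [leRHS]/Num.norm /= mx_normrE; apply/bigmax_geP; right => /=; exists j.
Qed.

Lemma convex_body_vol_gt0 : (0 < mu K)%E.
Proof.
have [c [r [r0 rK]]] := convex_body_ball.
have mB := @measurable_box R n (r / 2).
have -> : mu K = (\int[mu]_x (\1_K (x + c))%:E)%E.
  have mI : measurable_fun setT (fun x => (\1_K x : R)%:E).
    by apply/measurable_EFinP; apply: measurable_indic; exact: convex_body_measurable.
  rewrite (ge0_integral_rV_shift c mI) ?integral_indic ?setIT//; exact: convex_body_measurable.
apply: (@lt_le_trans _ _ (mu (@box _ n (r / 2)))).
  by rewrite lebesgue_rV_box ?lte_fin ?exprn_gt0 ?mulr_gt0 ?divr_ge0 ?divr_gt0// ltW.
rewrite -[X in mu X]setIT -integral_indic//; apply: ge0_le_integral => //.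
- by apply/measurable_EFinP; exact: measurable_indic.
- apply/measurable_EFinP; apply: measurable_indic_comp; first exact: convex_body_measurable.
  exact: measurable_addr_rV.
- move=> x _; rewrite lee_fin !indicE; have [xB|] := boolP (x \in _) => //.
  rewrite mem_set// addrC; apply: rK => i; move: xB; rewrite inE => /(_ i) h.
  by rewrite (le_lt_trans h)// gtr_pMr// invf_lt1// ltr1n.
Qed.

Let V := fine (mu K).

Lemma convex_body_volE : mu K = V%:E.
Proof. by rewrite /V fineK// ge0_fin_numE// convex_body_vol_lty. Qed.

Lemma convex_body_fine_gt0 : 0 < V.
Proof. by rewrite -lte_fin -convex_body_volE convex_body_vol_gt0. Qed.

Let mK := convex_body_measurable.

Let mind (u : 'rV[R]_n) : measurable_fun setT (fun x => (\1_K x * \1_K (x + u) : R)%:E).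
Proof.
by have := measurableT_comp (measurable_autocorrelation_fun mK) (pair1_measurable u).
Qed.

(** If x and x + t z lie in K, so does x + s z = (s / t) (x + t z) + (1 - s / t) x; hence the
    integrands are already ordered pointwise. *)
Lemma autocorrelation_nonincreasing z (s t : R) : 0 <= s -> s <= t ->
  (autocorrelation K (t *: z) <= autocorrelation K (s *: z))%E.
Proof.
rewrite le_eqVlt => /predU1P[<- t0|s0 st].
  apply: ge0_le_integral => // x _; rewrite lee_fin scale0r addr0 !indicE.
  by case: (x \in K); rewrite ?mul0r// !mul1r; case: (_ \in _); rewrite ?lexx ?ler01.
apply: ge0_le_integral => // x _; rewrite lee_fin !indicE.
have [xK|_] := boolP (x \in K); last by rewrite !mul0r.
rewrite !mul1r; have [xtK|//] := boolP (x + t *: z \in K).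
rewrite mem_set//; rewrite !inE in xK xtK.
have t0 : 0 < t := lt_le_trans s0 st.
have := @convex_bodyP _ _ (s / t) xtK xK.
rewrite divr_ge0 ?(ltW s0) ?(ltW t0)//= ler_pdivrMr// mul1r st => /(_ isT).
rewrite scalerDr scalerA divfK ?gt_eqF// scalerBl scale1r addrACA.
by rewrite addrAC addrCA subrr addr0 addrC.
Qed.

Lemma autocorrelation_le u : (autocorrelation K u <= V%:E)%E.
Proof.
rewrite -convex_body_volE -[X in mu X]setIT -integral_indic//.
apply: ge0_le_integral => //.
- by apply/measurable_EFinP; exact: measurable_indic.
- by move=> x _; rewrite lee_fin ler_piMr// indicE; case: (_ \in _).
Qed.

(* (1 - d) K + d c is contained in both K and K - h. *)
Lemma autocorrelation_ge (c : 'rV[R]_n) (r : R) (h : 'rV[R]_n) (d : R) :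
  (forall h : 'rV[R]_n, (forall i, `|h ord0 i| < r) -> K (c + h)) ->
  0 < d -> d < 1 -> (forall i, `|h ord0 i| < d * r) ->
  (((1 - d) ^+ n * V)%:E <= autocorrelation K h)%E.
Proof.
move=> rK d0 d1 hd.
pose f x : \bar R := (\1_K ((1 - d)^-1 *: (x - d *: c)))%:E.
have d'0 : 0 < 1 - d by lra.
have mf : measurable_fun setT f.
  apply/measurable_EFinP; apply: measurable_indic_comp => //.
  apply: measurable_scale_rV => //; exact: measurable_addr_rV.
have fV : (\int[mu]_x f x = ((1 - d) ^+ n * V)%:E)%E.
  rewrite (ge0_integral_rV_scale (c := 1 - d)) ?gt_eqF//; last first.
    by move=> x; rewrite lee_fin.
  rewrite gtr0_norm// EFinM -convex_body_volE; congr (_ * _)%E.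
  have mI : measurable_fun setT (fun x => (\1_K x : R)%:E).
    by apply/measurable_EFinP; exact: measurable_indic.
  rewrite -[RHS](_ : (\int[mu]_x (\1_K x)%:E = _)%E); last by rewrite integral_indic// setIT.
  rewrite -(ge0_integral_rV_shift (- ((1 - d)^-1 * d) *: c) mI); last by move=> x; rewrite lee_fin.
  apply: eq_integral => x _; rewrite /f; congr (\1_K _)%:E.
  by rewrite scalerBr !scalerA mulVf ?gt_eqF// scale1r scaleNr.
rewrite -fV; apply: ge0_le_integral => // x _; first by rewrite lee_fin.
rewrite lee_fin /f !indicE; have [|_] := boolP (_ \in K); last by rewrite mulr_ge0.
rewrite inE; set y := (X in K X) => Ky.
have xE : x = (1 - d) *: y + d *: c.
  by rewrite /y scalerA divff ?gt_eqF// scale1r subrK.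
(* This is h = 0 in the hypothesis on c; positivity of r is read off from |h_i| < d r. *)
have Kc : K c.
  by rewrite -[c]addr0; apply: rK => i; rewrite mxE normr0;
    rewrite -(pmulr_rgt0 _ d0) (le_lt_trans _ (hd i)).
have cvx v : K v -> K ((1 - d) *: y + d *: v).
  move=> Kv; have := @convex_bodyP y v (1 - d) Ky Kv.
  by rewrite (_ : 1 - (1 - d) = d) ?subKr//; apply; lra.
rewrite !mem_set ?mul1r//.
  rewrite xE -addrA (_ : d *: c + h = d *: (c + d^-1 *: h)).
    apply: cvx; apply: rK => i; rewrite mxE normrM gtr0_norm ?invr_gt0//.
    by rewrite mulrC ltr_pdivrMr// mulrC.
  by rewrite scalerDr scalerA divff ?gt_eqF// scale1r.
by rewrite xE; exact: cvx.
Qed.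

(** Squeezed between (1 - d)^n V and V, where d tends to 0 like 1 / (k + 1). *)
Lemma cvg_autocorrelation z :
  autocorrelation K (k.+1%:R^-1 *: z) @[k --> \oo] --> V%:E.
Proof.
have [c [r [r0 rK]]] := convex_body_ball.
(* Chosen so that |z_i| / (k + 1) < d k * r for every i; the added 1 makes the inequality strict and
   M positive. *)
pose M := (norm1 z + 1) / r.
have M0 : 0 < M by rewrite divr_gt0// ltr_wpDl// norm1_ge0.
pose d (k : nat) : R := M * k.+1%:R^-1.
have d0 k : 0 < d k by rewrite mulr_gt0// invr_gt0.
have cd : d k @[k --> \oo] --> (0 : R).
  by rewrite -(mulr0 M); apply: cvgMr; exact: (@cvg_harmonic R).
apply: (@squeeze_cvge _ _ _ _ (fun k => ((1 - d k) ^+ n * V)%:E) _ (fun=> V%:E)).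
- near=> k; rewrite autocorrelation_le andbT; apply: (autocorrelation_ge rK) => //.
    by near: k; apply: (cvgr_lt 0 cd); exact: ltr01.
  move=> i; rewrite mxE normrM ger0_norm ?invr_ge0// mulrC /d /M mulrAC divfK ?gt_eqF//.
  by rewrite ltr_pM2r ?invr_gt0// (le_lt_trans (coord_le_norm1 _ _))// ltrDl.
- apply: cvg_EFin; first exact: nearW.
  rewrite -[X in _ --> X]mul1r; apply: cvgMl.
  have c1 : 1 - d k @[k --> \oo] --> (1 - 0 : R) by apply: cvgB => //; exact: cvg_cst.
  have := continuous_cvg _ (@exprn_continuous R n (1 - 0)) c1.
  by rewrite subr0 expr1n; apply.
- exact: cvg_cst.
Unshelve. all: by end_near. Qed.

Lemma plancherel_convex_body :
  (\int[mu]_y (power_spectrum K y)%:E = ((2 * pi) ^+ n * V)%:E)%E.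
Proof.
apply: plancherel_indicator; first exact: convex_body_measurable.
- exact: convex_body_volE.
- move=> z k l kl; apply: autocorrelation_nonincreasing; first by rewrite invr_ge0.
  by rewrite lef_pV2 ?posrE// ler_nat ltnS.
- exact: cvg_autocorrelation.
Qed.

End convex_body.

(** * Fourier mean bodies *)

Section moments.
Context {R : realType}.
Notation mu := (@lebesgue_measure R).
Local Open Scope ereal_scope.

Let A : set R := `]0%R, +oo[%classic.

(** The extremal case of the comparison of moments: for the indicator of ]0, M] the mean (q int g
    r^(q - 1))^(1/q) is M whatever q. *)
Lemma integral_powR_indic (M q : R) : (0 < M)%R -> (0 < q)%R ->
  \int[mu]_(r in A) (\1_`]0%R, M] r * r `^ (q - 1))%:E = (M `^ q / q)%:E.
Proof.
move=> M0 q0; rewrite -(integral_powR_itvoc M0 q0) [LHS]integral_indicM [RHS]integral_indicM.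
apply: eq_integral => r _; rewrite -!EFinM mulrA; congr (_ * _)%:E.
rewrite !indicE /A !mem_setE !in_itv/= andbT.
by case: (0 < r)%R; rewrite ?mul1r ?mul0r.
Qed.

Context (g : R -> R) (mg : measurable_fun setT g).
Hypotheses (g0 : forall r, (0 <= g r)%R) (g1 : forall r, (g r <= 1)%R).

Definition moment (p : R) : \bar R := \int[mu]_(r in A) (g r * r `^ (p - 1))%:E.

Lemma moment_ge0 p : 0 <= moment p.
Proof. by apply: integral_ge0 => r _; rewrite lee_fin mulr_ge0 ?powR_ge0. Qed.

(* (g - 1_]0, M]) (r^(p - q) - M^(p - q)) is nonpositive for every r > 0. *)
Lemma moment_le (p q M : R) : (0 < p)%R -> (p < q)%R -> (0 < M)%R ->
  q%:E * moment q <= (M `^ q)%:E -> p%:E * moment p <= (M `^ p)%:E.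
Proof.
move=> p0 pq M0 hq; have q0 := lt_trans p0 pq.
have mA : measurable A by exact: measurable_itv.
have mgp s : measurable_fun A (fun r => (g r * r `^ (s - 1))%:E).
  apply/measurable_EFinP; apply: measurable_funTS.
  by apply: measurable_funM => //; exact: measurable_powR_comp.
have mip s : measurable_fun A (fun r => (\1_`]0%R, M] r * r `^ (s - 1))%:E).
  apply/measurable_EFinP; apply: measurable_funTS.
  by apply: measurable_funM; [exact: measurable_indic|exact: measurable_powR_comp].
have gp0 s r : 0 <= (g r * r `^ (s - 1))%:E by rewrite lee_fin mulr_ge0 ?powR_ge0.
have ip0 s r : 0 <= (\1_`]0%R, M] r * r `^ (s - 1))%:E.
  by rewrite lee_fin mulr_ge0 ?powR_ge0.
pose W : R := (M `^ (p - q))%R.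
have W0 : (0 <= W)%R by exact: powR_ge0.
(* The integrated form of the pointwise inequality, with each term on the side where its sign is
   plus: finiteness of the moments is derived only afterwards. [W] is the value of r^(p - q) at the
   cut r = M. *)
have H : moment p + W%:E * (M `^ q / q)%:E <= W%:E * moment q + (M `^ p / p)%:E.
  rewrite -!integral_powR_indic// /moment -!ge0_integralZl//;
    do ?[exact: mgp|exact: mip].
  have mWg s := measurable_funeM W%:E (mgp s).
  have mWi s := measurable_funeM W%:E (mip s).
  rewrite -!ge0_integralD//; do ?[exact: mgp|exact: mip|exact: mWg|exact: mWi|
    by move=> r _; rewrite mule_ge0].
  apply: ge0_le_integral => //.
  - by move=> r _; rewrite adde_ge0// mule_ge0.
  - exact: emeasurable_funD (mgp p) (mWi q).
  - exact: emeasurable_funD (mWg q) (mip p).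
  move=> r; rewrite /A/= in_itv/= andbT => r0.
  rewrite -!EFinM -!EFinD lee_fin.
  have -> : (r `^ (p - 1) = r `^ (p - q) * r `^ (q - 1))%R.
    by rewrite -powRD ?(gt_eqF r0) ?implybT//; congr (_ `^ _)%R; ring.
  set a := (r `^ (q - 1))%R; set w := (r `^ (p - q))%R.
  have a0 : (0 <= a)%R by exact: powR_ge0.
  have negE (x : R) : (x `^ (p - q) = (x `^ (q - p))^-1)%R by rewrite -powRN opprB.
  have qp0 : (0 <= q - p)%R by rewrite subr_ge0 ltW.
  rewrite indicE mem_setE in_itv/= r0/=.
  have [rM|Mr] := leP r M.
    have Ww : (W <= w)%R.
      rewrite /W /w !negE lef_pV2 ?posrE ?powR_gt0//.
      by rewrite ge0_ler_powR// nnegrE ltW.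
    have : (0 <= a * ((1 - g r) * (w - W)))%R.
      by rewrite !mulr_ge0// subr_ge0.
    by rewrite /=; lra.
  have wW : (w <= W)%R.
    rewrite /W /w !negE lef_pV2 ?posrE ?powR_gt0//.
    by rewrite ge0_ler_powR// ?nnegrE ltW.
  have : (0 <= a * (g r * (W - w)))%R by rewrite !mulr_ge0// subr_ge0.
  by rewrite /=; lra.
have qf : moment q \is a fin_num.
  rewrite ge0_fin_numE ?moment_ge0//; move: hq; case: (moment q) => //=.
  - by move=> *; rewrite ltry.
  - by rewrite gt0_muley ?lte_fin// leye_eq.
have pf : moment p \is a fin_num.
  rewrite ge0_fin_numE ?moment_ge0//; move: H; rewrite -(fineK qf).
  case: (moment p) => //=.
  by move=> *; rewrite ltry.
move: H hq qf pf; generalize (moment p) (moment q).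
move=> [a| |]// [j| |]//; rewrite -!EFinM -!EFinD !lee_fin => H hq _ _.
have jM : (W * j <= W * (M `^ q / q))%R.
  by rewrite ler_wpM2l// ler_pdivlMr// mulrC.
by rewrite -ler_pdivlMl// mulrC; lra.
Qed.

(** This is [moment_le] with M the mean of order q. That mean may vanish while M must be positive,
    so M is the mean plus an arbitrary e > 0. *)
Lemma moment_poweR_le (p q : R) : (0 < p)%R -> (p < q)%R ->
  (p%:E * moment p) `^ p^-1 <= (q%:E * moment q) `^ q^-1.
Proof.
move=> p0 pq; have q0 := lt_trans p0 pq.
have pinv0 : (0 <= p^-1)%R by rewrite invr_ge0 ltW.
have qm0 : 0 <= q%:E * moment q by rewrite mule_ge0 ?moment_ge0 ?lee_fin ?ltW.
have [->|/eqP qy] := eqVneq (q%:E * moment q) +oo.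
  by rewrite poweRyr ?leey// invr_eq0 gt_eqF.
have qf : q%:E * moment q \is a fin_num by rewrite ge0_fin_numE// ltey; exact/eqP.
move: qm0; rewrite -(fineK qf); set m := fine _; rewrite lee_fin => m0.
apply/lee_addgt0Pr => e e0; rewrite poweR_EFin -EFinD.
set M := (m `^ q^-1 + e)%R.
have M0 : (0 < M)%R by rewrite ltr_wpDl ?powR_ge0.
have -> : M%:E = (M `^ p)%:E `^ p^-1.
  by rewrite poweR_EFin -powRrM divff ?gt_eqF// powRr1// ltW.
have pM : p%:E * moment p <= (M `^ p)%:E.
  apply: (moment_le p0 pq M0); rewrite -(fineK qf) -/m lee_fin.
  have -> : m = ((m `^ q^-1) `^ q)%R.
    by rewrite -powRrM mulVf ?gt_eqF// powRr1.
  apply: ge0_ler_powR; rewrite ?nnegrE ?powR_ge0 ?(ltW q0) ?(ltW M0)//.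
  by rewrite /M lerDl ltW.
apply: gt0_ler_poweR => //.
- by rewrite in_itv/= leey andbT mule_ge0 ?moment_ge0 ?lee_fin ?ltW.
- by rewrite in_itv/= leey andbT lee_fin powR_ge0.
Qed.

End moments.

(** * Volume of a star-shaped set in terms of its radial function *)

Section star_volume.
Context {R : realType} (n : nat) (n0 : (0 < n)%N).
Local Open Scope ereal_scope.
Notation mu := (@lebesgue_measure R).
Context (rho : 'rV[R]_n -> \bar R) (mrho : measurable_fun setT rho).
Hypothesis rho0 : forall x, 0 <= rho x.

Lemma measurable_star_of : measurable (star_of rho).
Proof.
pose b (x : 'rV[R]_n) := (enorm x)%:E <= rho ((enorm x)^-1 *: x)%R.
have mb : measurable_fun setT b.
  apply: measurable_fun_lee.
    by apply/measurable_EFinP; exact: measurable_enorm.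
  exact: (measurableT_comp mrho (@measurable_normalize R n)).
rewrite (_ : star_of rho = [set 0%R] `|` b @^-1` [set true]).
  apply: measurableU; first exact: measurable_rV0.
  by rewrite -[X in measurable X]setTI; exact: mb.
by apply/seteqP; split => x.
Qed.

(** The contribution of one direction to the volume of a star-shaped set; t is infinite when the set
    contains the whole ray. *)
Lemma integral_powR_le_ereal (t : \bar R) : 0 <= t ->
  \int[mu]_(r in `]0%R, +oo[) ((r `^ (n%:R - 1))%:E * (r%:E <= t)%E%:R%:E) =
  t `^ n%:R * (n%:R^-1)%:E.
Proof.
have nR : (0 < n%:R :> R)%R by rewrite ltr0n.
have real s : (0 < s)%R -> \int[mu]_(r in `]0%R, +oo[)
    ((r `^ (n%:R - 1))%:E * (r%:E <= s%:E)%E%:R%:E) = (s `^ n%:R / n%:R)%:E.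
  move=> s0; rewrite -integral_powR_indic//.
  apply: eq_integral => r; rewrite inE/= in_itv/= andbT => r0.
  by rewrite -EFinM mulrC indicE mem_setE in_itv/= r0 lee_fin.
case: t => [s|_|//].
  rewrite lee_fin le_eqVlt => /predU1P[<-|s0]; last by rewrite real// poweR_EFin.
  rewrite poweR0r ?gt_eqF// mul0e integral0_eq// => r.
  by rewrite /= in_itv/= andbT lee_fin leNgt => ->; rewrite mule0.
rewrite poweRyr ?gt_eqF// mulyr gtr0_sg ?invr_gt0// mul1e.
have yE (r : R) : (r%:E <= +oo)%E = true by exact: leey.
(* An infinite ray contains every finite segment; s is the length for which s^n / n is the given
   a. *)
apply/eqyP => a a0.
pose s : R := ((a * n%:R) `^ n%:R^-1)%R.
have s0 : (0 < s)%R by rewrite powR_gt0// mulr_gt0.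
have -> : a%:E = (s `^ n%:R / n%:R)%:E.
  by rewrite /s -powRrM mulVf ?gt_eqF// powRr1 ?mulr_ge0 ?ltW// mulfK ?gt_eqF.
rewrite -real//; apply: ge0_le_integral => //.
- by move=> r _; rewrite mule_ge0// lee_fin ?powR_ge0.
- apply: emeasurable_funM; apply/measurable_EFinP; apply: measurable_funTS.
    exact: measurable_powR_comp.
  rewrite (_ : (fun _ => _) = \1_`]-oo, s]).
    exact: measurable_indic.
  by apply/funext => r; rewrite indicE mem_setE in_itv/= lee_fin.
- rewrite (_ : (fun _ => _) = (fun r : R => (r `^ (n%:R - 1))%:E)); last first.
    by apply/funext => r; rewrite yE mule1.
  by apply/measurable_EFinP; apply: measurable_funTS; exact: measurable_powR_comp.
- move=> r _; rewrite yE mule1 -EFinM lee_fin -[X in (_ <= X)%R]mulr1.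
  by rewrite ler_wpM2l ?powR_ge0//; case: (_ <= _).
Qed.

Lemma vol_star_of : n%:R%:E * vol (star_of rho) =
  \int[@sphere_measure R n]_(x in @sphere R n) (rho x `^ n%:R).
Proof.
have nR : (0 < n%:R :> R)%R by rewrite ltr0n.
have mS := measurable_star_of.
have mI : measurable_fun setT (fun x : 'rV[R]_n => (\1_(star_of rho) x : R)%:E).
  by apply/measurable_EFinP; exact: measurable_indic.
rewrite /vol -[X in lebesgue_rV X]setIT -integral_indic// ge0_integral_polar//.
rewrite (eq_integral (fun x => rho x `^ n%:R * (n%:R^-1)%:E)); last first.
  move=> x; rewrite inE => Sx; rewrite -integral_powR_le_ereal//.
  apply: eq_integral => r; rewrite inE/= in_itv/= andbT => r0; congr (_ * _%:E).
  rewrite indicE; congr (nat_of_bool _)%:R.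
  have x0 : x != 0%R.
    by apply: contra_eq_neq Sx => ->; rewrite enorm0 eq_sym oner_eq0.
  have rx : enorm (r *: x)%R = r by rewrite enormZ Sx mulr1 gtr0_norm.
  apply/idP/idP.
    rewrite inE /star_of/= rx scalerA mulVf ?gt_eqF// scale1r => -[/eqP|//].
    by rewrite scaler_eq0 gt_eqF//= (negbTE x0).
  by move=> h; rewrite inE /star_of/= rx scalerA mulVf ?gt_eqF// scale1r; right.
rewrite ge0_integralZr//.
- by rewrite muleCA -EFinM divff ?gt_eqF// mule1.
- exact: measurable_sphere.
- apply: measurable_funTS; exact: (measurableT_comp (measurable_poweR n%:R) mrho).
- by move=> x _; exact: poweR_ge0.
Qed.

End star_volume.

(** * Volume, inclusions and integrability of the Fourier mean bodies *)

Section fourier_mean_body.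
Context {R : realType} (n : nat).
Local Open Scope ereal_scope.
Notation mu := (@lebesgue_measure R).
Context (K : set 'rV[R]_n) (cK : convex_body K).
Implicit Types (x y : 'rV[R]_n) (p q : R).

Let V : R := fine (vol K).

Let V0 : (0 < V)%R. Proof. exact: convex_body_fine_gt0. Qed.

Let mps : measurable_fun setT (power_spectrum K).
Proof. exact: measurable_power_spectrum (convex_body_measurable cK) (convex_body_volE cK). Qed.

Definition radial_moment p y : \bar R :=
  \int[mu]_(r in `]0%R, +oo[) (power_spectrum K (r *: y) * r `^ (p - 1))%:E.

Lemma radial_moment_ge0 p y : 0 <= radial_moment p y.
Proof.
by apply: integral_ge0 => r _; rewrite lee_fin mulr_ge0 ?powR_ge0 ?power_spectrum_ge0.
Qed.

Lemma fourier_radialE p y :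
  fourier_radial p K y = ((p / V)%:E * radial_moment p y) `^ p^-1.
Proof. by []. Qed.

Lemma measurable_radial_moment p : measurable_fun setT (radial_moment p).
Proof.
pose J (z : R * 'rV[R]_n) : \bar R :=
  (\1_`]0%R, +oo[ z.1 : R)%:E * (power_spectrum K (z.1 *: z.2) * z.1 `^ (p - 1))%:E.
have mJ : measurable_fun setT J.
  apply: emeasurable_funM; apply/measurable_EFinP.
    by apply: measurable_indic_comp => //; exact: measurable_fst.
  apply: measurable_funM; last exact: measurable_powR_comp.
  have msc : measurable_fun setT (fun z : R * 'rV[R]_n => z.1 *: z.2)%R.
    exact: measurable_scale_rV.
  exact: (measurableT_comp mps msc).
have J0 z : 0 <= J z.
  by rewrite mule_ge0 ?lee_fin ?(mulr_ge0 (power_spectrum_ge0 _ _))// powR_ge0.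
rewrite (_ : radial_moment p = fun y => \int[mu]_r J (r, y)).
  exact: (@measurable_fun_fubini_tonelli_G _ _ _ _ R mu J mJ J0).
by apply/funext => y; rewrite /radial_moment integral_indicM.
Qed.

Lemma measurable_fourier_radial p : measurable_fun setT (fourier_radial p K).
Proof.
apply: (measurableT_comp (measurable_poweR p^-1)).
exact: measurable_funeM (measurable_radial_moment p).
Qed.

Lemma fourier_radial_ge0 p y : 0 <= fourier_radial p K y.
Proof. exact: poweR_ge0. Qed.

(** With g = |f^|^2 / V^2, bounded by 1, the factor (p / V) |f^|^2 is p V g. The power V^(1/p)
    pulled out here produces V^(1/p - 1/q) in the inclusion. *)
Lemma fourier_radial_moment p y : (0 < p)%R ->
  fourier_radial p K y = (V `^ p^-1)%:E *
    (p%:E * moment (fun r => power_spectrum K (r *: y) / V ^+ 2)%R p) `^ p^-1.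
Proof.
move=> p0; rewrite fourier_radialE -poweR_EFin -poweRM ?lee_fin ?(ltW V0)//; last first.
  rewrite mule_ge0 ?lee_fin ?(ltW p0)//; apply: moment_ge0 => r.
  by rewrite divr_ge0 ?sqr_ge0 ?power_spectrum_ge0.
congr (_ `^ _); rewrite /moment (_ : (fun r => _) = fun r =>
    (V ^- 2)%:E * (power_spectrum K (r *: y) * r `^ (p - 1))%:E); last first.
  by apply/funext => r; rewrite -EFinM; congr (_%:E); ring.
rewrite ge0_integralZl//; first last.
- by rewrite lee_fin invr_ge0 sqr_ge0.
- by move=> r _; rewrite lee_fin mulr_ge0 ?powR_ge0 ?power_spectrum_ge0.
- apply/measurable_EFinP; apply: measurable_funTS; apply: measurable_funM.
    have msc : measurable_fun setT (fun r : R => r *: y)%R by exact: measurable_scale_rV.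
    exact: (measurableT_comp mps msc).
  exact: measurable_powR_comp.
rewrite !muleA -!EFinM; congr (_%:E * _).
by field; rewrite gt_eqF.
Qed.

Lemma fourier_radial_le p q y : (0 < p)%R -> (p < q)%R ->
  fourier_radial p K y <= (V `^ (p^-1 - q^-1))%:E * fourier_radial q K y.
Proof.
move=> p0 pq; have q0 := lt_trans p0 pq; rewrite !fourier_radial_moment// muleA -EFinM.
rewrite -powRD ?(gt_eqF V0) ?implybT// subrK lee_wpmul2l ?lee_fin ?powR_ge0//.
have msc : measurable_fun setT (fun r : R => r *: y)%R by exact: measurable_scale_rV.
apply: moment_poweR_le => //.
- by apply: measurable_funM => //; exact: (measurableT_comp mps msc).
- by move=> r; rewrite divr_ge0 ?sqr_ge0 ?power_spectrum_ge0.
- move=> r; rewrite ler_pdivrMr ?exprn_gt0// mul1r.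
  exact: power_spectrum_le (convex_body_measurable cK) (convex_body_volE cK) _.
Qed.

Hypothesis n0 : (0 < n)%N.

Let nR : (0 < n%:R :> R)%R. Proof. by rewrite ltr0n. Qed.

Lemma integral_radial_moment :
  \int[@sphere_measure R n]_(x in @sphere R n) radial_moment n%:R x =
  ((2 * pi) ^+ n * V)%:E.
Proof.
have mS : measurable_fun setT (fun y => (power_spectrum K y)%:E).
  exact/measurable_EFinP.
have S0 y : 0 <= (power_spectrum K y)%:E by rewrite lee_fin power_spectrum_ge0.
rewrite -(plancherel_convex_body cK).
apply: etrans _ (esym (ge0_integral_polar n0 mS S0)).
apply: eq_integral => x _; apply: eq_integral => r _.
by rewrite -EFinM mulrC.
Qed.

Lemma integral_fourier_radial :
  \int[@sphere_measure R n]_(x in @sphere R n) (fourier_radial n%:R K x `^ n%:R) =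
  (n%:R * (2 * pi) ^+ n)%:E.
Proof.
under eq_integral do rewrite fourier_radialE -poweRrM mulVf ?gt_eqF// poweRe1
  ?mule_ge0 ?radial_moment_ge0 ?lee_fin ?divr_ge0 ?(ltW V0)//.
rewrite ge0_integralZl//; first last.
- by rewrite lee_fin divr_ge0// ltW.
- by move=> x _; exact: radial_moment_ge0.
- by apply: measurable_funTS; exact: measurable_radial_moment.
- exact: measurable_sphere.
rewrite integral_radial_moment -EFinM; congr (_%:E).
by field; rewrite gt_eqF.
Qed.

Lemma vol_fourier_mean_body : vol (fourier_mean_body n%:R K) = ((2 * pi) ^+ n)%:E.
Proof.
have := vol_star_of n0 (measurable_fourier_radial n%:R) (fourier_radial_ge0 n%:R).
rewrite integral_fourier_radial EFinM => /(congr1 (fun t => (n%:R^-1)%:E * t)).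
by rewrite !muleA -EFinM mulVf ?gt_eqF// !mul1e.
Qed.

Lemma star_sub_fourier_mean_body p q : (0 < p)%R -> (p < q)%R ->
  star_sub (fourier_mean_body p K)
    (dilate (V `^ (p^-1 - q^-1)) (fourier_mean_body q K)).
Proof.
move=> p0 pq th th1; rewrite /radial; set c := (V `^ _)%R.
have c0 : (0 < c)%R by rewrite powR_gt0.
have th0 : th != 0%R.
  by apply: contra_eq_neq th1 => ->; rewrite enorm0 eq_sym oner_eq0.
rewrite ge_max le_max lexx/= le_max; apply/orP; right.
apply: ereal_sup_le => _ [t [t0 Mt] <-]; exists t => //; split => //.
exists (c^-1 * t *: th)%R; last by rewrite scalerA mulrA divff ?gt_eqF// mul1r.
have ct0 : (0 < c^-1 * t)%R by rewrite mulr_gt0 ?invr_gt0.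
have E s : (0 < s)%R -> enorm (s *: th) = s.
  by move=> s0; rewrite enormZ th1 mulr1 gtr0_norm.
right; rewrite E// scalerA mulVf ?gt_eqF// scale1r.
case: Mt => [/eqP|].
  by rewrite scaler_eq0 gt_eqF//= (negbTE th0).
rewrite E// scalerA mulVf ?gt_eqF// scale1r => tp.
rewrite EFinM lee_pdivrMl//.
exact: le_trans tp (fourier_radial_le _ p0 pq).
Qed.

Lemma Ln_star_fourier_mean_body p : (0 < p)%R -> (p <= n%:R)%R ->
  Ln_star (fourier_mean_body p K).
Proof.
move=> p0 pn; have mS := @measurable_sphere R n.
have radE th : sphere th -> radial (fourier_mean_body p K) th = fourier_radial p K th.
  by move=> th1; rewrite radial_star_of// fourier_radial_ge0.
split.
- split; first by left.
  move=> x t [->|xM] /andP[t0 t1]; first by left; rewrite scaler0.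
  have [->|tn0] := eqVneq t 0%R; first by left; rewrite scale0r.
  have {}t0 : (0 < t)%R by rewrite lt_neqAle eq_sym tn0.
  have E : ((enorm (t *: x))^-1 *: (t *: x) = (enorm x)^-1 *: x)%R.
    by rewrite enormZ gtr0_norm// scalerA invfM mulrAC mulVf ?mul1r.
  right; rewrite E; apply: le_trans xM.
  by rewrite lee_fin enormZ gtr0_norm// ler_piMl// enorm_ge0.
- apply: contrapT => h.
  (* Otherwise the power spectrum vanishes almost everywhere on every ray,
     which contradicts Plancherel's formula. *)
  have rad0 th : sphere th -> radial_moment n%:R th = 0.
    move=> th1; have : fourier_radial p K th = 0.
      rewrite -radE//; apply/eqP; apply: contrapT => /negP radn0.
      by apply: h; exists th.
    rewrite fourier_radialE => /poweR_eq0_eq0.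
    rewrite mule_ge0 ?radial_moment_ge0 ?lee_fin ?divr_ge0 ?(ltW V0) ?(ltW p0)//.
    move=> /(_ isT) /eqP; rewrite mule_eq0 eqe mulf_eq0 invr_eq0 (gt_eqF p0) (gt_eqF V0)/= => /eqP.
    have mr (s : R) : measurable_fun (`]0%R, +oo[%classic : set R)
        (fun r : R => (power_spectrum K (r *: th) * r `^ (s - 1))%:E).
      apply/measurable_EFinP; apply: measurable_funTS; apply: measurable_funM.
        have msc : measurable_fun setT (fun r : R => r *: th)%R.
          exact: measurable_scale_rV.
        exact: (measurableT_comp mps msc).
      exact: measurable_powR_comp.
    have absE (s : R) : \int[mu]_(r in `]0%R, +oo[)
        `|(power_spectrum K (r *: th) * r `^ (s - 1))%:E| = radial_moment s th.
      apply: eq_integral => r _; rewrite gee0_abs// lee_fin.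
      by rewrite mulr_ge0 ?powR_ge0 ?power_spectrum_ge0.
    (* On r > 0 the weight r^(s - 1) is positive, so a vanishing moment of order p forces the
       integrand of order n to vanish almost everywhere as well. *)
    rewrite -!absE => /(ae_eq_integral_abs mu (measurable_itv _) (mr p)) h0.
    apply/(ae_eq_integral_abs mu (measurable_itv _) (mr n%:R)).
    apply: filterS h0 => r hr r0; have {hr} := hr r0; rewrite /= => -[] /eqP.
    move: r0; rewrite /= in_itv/= andbT => r0.
    rewrite mulf_eq0 (gt_eqF (powR_gt0 _ r0)) orbF => /eqP ->.
    by rewrite mul0r.
  have := integral_radial_moment; rewrite integral0_eq// => -[] /eqP.
  by rewrite eq_sym mulf_eq0 expf_eq0 (gt_eqF V0) orbF mulf_eq0 (gt_eqF (pi_gt0 R))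
    orbF pnatr_eq0 andbF.
- apply: (eq_measurable_fun (fourier_radial p K)).
    by move=> x; rewrite inE => xS; rewrite radE.
  exact: measurable_funTS (measurable_fourier_radial p).
- have mr q : measurable_fun (@sphere R n) (fun x => fourier_radial q K x `^ n%:R).
    apply: measurable_funTS.
    exact: (measurableT_comp (measurable_poweR n%:R) (measurable_fourier_radial q)).
  rewrite (eq_integral (fun x => fourier_radial p K x `^ n%:R)); last first.
    by move=> x; rewrite inE => xS; rewrite radE.
  move: pn; rewrite le_eqVlt => /predU1P[->|pn].
    by rewrite integral_fourier_radial ltry.
  pose c := (V `^ (p^-1 - n%:R^-1))%R.
  apply: (@le_lt_trans _ _ (\int[@sphere_measure R n]_(x in @sphere R n)
      ((c%:E `^ n%:R) * (fourier_radial n%:R K x `^ n%:R)))).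
    apply: ge0_le_integral => //.
    + by move=> x _; exact: poweR_ge0.
    + by apply: measurable_funeM.
    + move=> x _; rewrite -poweRM ?lee_fin ?powR_ge0 ?fourier_radial_ge0//.
      apply: gt0_ler_poweR; rewrite ?ler0n// ?in_itv/= ?leey ?andbT.
      * exact: fourier_radial_ge0.
      * by rewrite mule_ge0 ?fourier_radial_ge0// lee_fin powR_ge0.
      * exact: fourier_radial_le.
  rewrite ge0_integralZl//.
  + by rewrite integral_fourier_radial poweR_EFin -EFinM ltry.
  + by move=> x _; exact: poweR_ge0.
  + exact: poweR_ge0.
Qed.

End fourier_mean_body.

(** * Affine invariance *)

Section affine_substitution.
Context {R : realType} (n : nat).
Notation mu := (@lebesgue_rV R n).
Context (T : 'M[R]_n) (x0 : 'rV[R]_n) (uT : T \in unitmx).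
Implicit Types (K : set 'rV[R]_n) (x y w : 'rV[R]_n).

Let D : R := `|\det T|.

Lemma absdet_gt0 : 0 < D.
Proof. by rewrite normr_gt0 -unitfE -unitmxE. Qed.

Lemma measurable_affine : measurable_fun setT (fun w => w *m T + x0).
Proof. exact: measurable_add_rV (measurable_mulmx T) (measurable_cst _). Qed.

Lemma ge0_integral_affine (f : 'rV[R]_n -> \bar R) :
  measurable_fun setT f -> (forall x, 0 <= f x)%E ->
  (\int[mu]_x f x = D%:E * \int[mu]_w f (w *m T + x0)%R)%E.
Proof.
move=> mf f0; rewrite -(ge0_integral_rV_shift x0 mf f0).
have mfs := measurableT_comp mf (measurable_addr_rV x0).
exact: (unitmx_substitution uT mfs (fun x => f0 _)).
Qed.

Lemma affine_image_indic K w : \1_(affine_image T x0 K) (w *m T + x0) = \1_K w :> R.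
Proof.
rewrite !indicE; congr (nat_of_bool _)%:R; apply/idP/idP; rewrite !inE; last by exists w.
by move=> [k Kk] /addIr /(can_inj (mulmxK uT)) <-.
Qed.

Lemma measurable_affine_image K : measurable K -> measurable (affine_image T x0 K).
Proof.
move=> mK; rewrite (_ : affine_image T x0 K = (fun x => (x - x0) *m invmx T) @^-1` K).
  rewrite -[X in measurable X]setTI.
  exact: (measurableT_comp (measurable_mulmx _) (measurable_addr_rV _)).
apply/seteqP; split => [x [k Kk <-]|x /= Kx].
  by rewrite /= addrK mulmxK.
by exists ((x - x0) *m invmx T) => //; rewrite mulmxKV// subrK.
Qed.

Lemma vol_affine_image K : measurable K ->
  mu (affine_image T x0 K) = (D%:E * mu K)%E.
Proof.
move=> mK; have mK' := measurable_affine_image mK.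
have mI : measurable_fun setT (fun x => (\1_(affine_image T x0 K) x : R)%:E).
  by apply/measurable_EFinP; exact: measurable_indic.
rewrite -[X in mu X]setIT -integral_indic// (ge0_integral_affine mI)//.
under eq_integral do rewrite affine_image_indic.
by rewrite integral_indic// setIT.
Qed.

Lemma dotp_mulmx w y : dotp (w *m T) y = dotp w (y *m T^T).
Proof.
rewrite /dotp; under eq_bigr do rewrite mxE mulr_suml.
rewrite exchange_big/=; apply: eq_bigr => i _; rewrite mxE mulr_sumr.
by apply: eq_bigr => j _; rewrite mxE -mulrA [T _ _ * _]mulrC.
Qed.

(** A nonnegative double integral to which the affine change of variables applies directly, with no
    complex phase to follow. *)
Lemma power_spectrum_double_integral K (V : R) y : measurable K -> mu K = V%:E ->
  ((V ^+ 2 + power_spectrum K y)%:E =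
   \int[mu]_x \int[mu]_x' (\1_K x * \1_K x' * (1 + cos (dotp (x' - x) y)))%:E)%E.
Proof.
move=> mK KV; rewrite (power_spectrum_autocorrelation mK KV) integral_autocorrelation//.
by apply: measurable_funD => //; apply: measurable_cos_comp; exact: measurable_dotp.
Qed.

(** Both points are substituted by w T + x0: only their difference enters the cosine, so x0 cancels,
    and each integral yields a factor D. The terms (D V)^2 then agree on both sides. *)
Lemma power_spectrum_affine_image K (V : R) y : measurable K -> mu K = V%:E ->
  power_spectrum (affine_image T x0 K) y = D ^+ 2 * power_spectrum K (y *m T^T).
Proof.
move=> mK KV; have mK' := measurable_affine_image mK.
have KV' : mu (affine_image T x0 K) = (D * V)%:E by rewrite vol_affine_image// KV.
set K' := affine_image T x0 K in mK' KV' *.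
pose F (z : 'rV[R]_n * 'rV[R]_n) : \bar R :=
  (\1_K' z.1 * \1_K' z.2 * (1 + cos (dotp (z.2 - z.1) y)))%:E.
have F0 z : (0 <= F z)%E.
  by rewrite lee_fin !mulr_ge0.
have mF : measurable_fun setT F.
  apply/measurable_EFinP; apply: measurable_funM.
    by apply: measurable_funM; apply: measurable_indic_comp.
  apply: measurable_funD => //; apply: measurable_cos_comp; apply: measurable_dotp => //.
  apply: measurable_add_rV => //.
  rewrite (_ : (fun x : 'rV[R]_n * 'rV[R]_n => - x.1) = (fun z => (-1) *: z.1)).
    exact: measurable_scale_rV.
  by apply/funext => z; rewrite scaleN1r.
have mA := measurable_affine.
pose F' (z : 'rV[R]_n * 'rV[R]_n) := F (z.1, z.2 *m T + x0).
have mF' : measurable_fun setT F'.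
  apply: (measurableT_comp mF); apply: measurable_fun_pair => //.
  exact: (measurableT_comp mA measurable_snd).
have F'0 z : (0 <= F' z)%E by exact: F0.
have := power_spectrum_double_integral y mK' KV'.
have -> : (\int[mu]_x \int[mu]_x' (\1_K' x * \1_K' x' * (1 + cos (dotp (x' - x) y)))%:E =
    \int[mu]_x (D%:E * \int[mu]_w F' (x, w)))%E.
  apply: eq_integral => x _.
  exact: (ge0_integral_affine (measurableT_comp mF (pair1_measurable x)) (fun w => F0 _)).
have mF'x : measurable_fun setT (fun x => \int[mu]_w F' (x, w))%E.
  exact: (@measurable_fun_fubini_tonelli_F _ _ _ _ R mu _ mF' F'0).
have F'x0 x : (0 <= \int[mu]_w F' (x, w))%E by exact: integral_ge0.
rewrite ge0_integralZl//; last by rewrite lee_fin normr_ge0.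
rewrite (ge0_integral_affine mF'x F'x0).
rewrite (_ : (\int[mu]_w \int[mu]_w' F' ((w *m T + x0)%R, w') =
    (V ^+ 2 + power_spectrum K (y *m T^T))%:E)%E); last first.
  rewrite (power_spectrum_double_integral _ mK KV); apply: eq_integral => w _.
  apply: eq_integral => w' _; rewrite /F' /F /= !affine_image_indic.
  by rewrite opprD addrACA subrr addr0 -mulmxBl dotp_mulmx.
rewrite -!EFinM => -[]; nra.
Qed.

End affine_substitution.

Lemma vol_preimage_mulmx (R : realType) (n : nat) (A : 'M[R]_n) (S : set 'rV[R]_n) :
  A \in unitmx -> measurable S ->
  vol S = (`|\det A|%:E * vol ((fun x => x *m A) @^-1` S))%E.
Proof.
move=> uA mS.
have mI : measurable_fun setT (fun x => (\1_S x : R)%:E).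
  by apply/measurable_EFinP; exact: measurable_indic.
rewrite /vol -[X in lebesgue_rV X]setIT -integral_indic//.
rewrite (unitmx_substitution uA mI); last by move=> x; rewrite lee_fin.
congr (_ * _)%E; rewrite -[X in lebesgue_rV X]setIT -integral_indic//.
rewrite -[X in measurable X]setTI; exact: measurable_mulmx.
Qed.

(** Homogeneity of degree -1 rewrites membership of a nonzero x in [star_of G] as 1 <= G x. Since
    c^-1 G (x A) = G (c x A), the condition for G' at x is the condition for G at x (c A). The
    origin is treated apart, as it belongs to every such set by definition. *)
Lemma star_of_preimage (R : realType) (n : nat) (G G' : 'rV[R]_n -> \bar R)
    (c : R) (A : 'M[R]_n) : (0 < c)%R -> A \in unitmx ->
  (forall (t : R) z, (0 < t)%R -> G z = t%:E * G (t *: z)%R)%E ->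
  (forall y, G' y = (c^-1)%:E * G (y *m A))%E ->
  star_of G' = (fun x => x *m (c *: A)) @^-1` (star_of G).
Proof.
move=> c0 uA GZ G'E; apply: funext => x; apply: propext.
have [->|xn0] := eqVneq x 0.
  by rewrite /preimage/= mul0mx; split => _; left.
have yn0 : x *m A != 0.
  by apply: contraNneq xn0 => xA0; rewrite -[x](mulmxK uA) xA0 mul0mx.
rewrite /preimage/= -scalemxAr; set y := x *m A in yn0 *.
have cyn0 : c *: y != 0 by rewrite scaler_eq0 gt_eqF.
have memP (H : 'rV[R]_n -> \bar R) z : z != 0 -> star_of H z <->
    ((enorm z)%:E <= H ((enorm z)^-1 *: z)%R)%E.
  by move=> z0; split; [case=> // z00; rewrite z00 eqxx in z0|right].
rewrite !memP//.
have GV (s : R) z : 0 < s -> (G (s^-1 *: z)%R = s%:E * G z)%E.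
  by move=> s0; rewrite (GZ s (s^-1 *: z))// scalerA divff ?gt_eqF// scale1r.
have -> : (G' ((enorm x)^-1 *: x)%R = (enorm x)%:E * ((c^-1)%:E * G y))%E.
  by rewrite G'E -scalemxAl GV ?enorm_gt0// muleCA.
have -> : (G ((enorm (c *: y))^-1 *: (c *: y))%R =
    (enorm (c *: y))%:E * ((c^-1)%:E * G y))%E.
  rewrite GV ?enorm_gt0//; congr (_ * _)%E; rewrite (GZ c y)// muleA -EFinM.
  by rewrite mulVf ?gt_eqF// mul1e.
have le1 (s : R) (t : \bar R) : 0 < s -> (s%:E <= s%:E * t)%E = (1 <= t)%E.
  by move=> s0; rewrite -lee_pdivrMl// -EFinM mulVf// gt_eqF.
by rewrite !le1 ?enorm_gt0.
Qed.

Section affine_invariance.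
Context {R : realType} (n : nat).
Local Open Scope ereal_scope.
Context (K : set 'rV[R]_n) (cK : convex_body K).
Notation mu := (@lebesgue_measure R).
Implicit Types (x y : 'rV[R]_n).

Let V : R := fine (vol K).
Let V0 : (0 < V)%R. Proof. exact: convex_body_fine_gt0. Qed.

(** Rescaling r by t shows that [radial_moment] is homogeneous of degree - p; the root of order p
    turns this into -1. *)
Lemma fourier_radialZ (p t : R) y : (0 < p)%R -> (0 < t)%R ->
  fourier_radial p K y = t%:E * fourier_radial p K (t *: y)%R.
Proof.
move=> p0 t0; rewrite !fourier_radialE.
have mps := measurable_power_spectrum (convex_body_measurable cK) (convex_body_volE cK).
have -> : radial_moment K p y = (t `^ p)%:E * radial_moment K p (t *: y)%R.
  pose J z (r : R) : \bar R := (\1_`]0%R, +oo[ r : R)%:E *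
    (power_spectrum K (r *: z) * r `^ (p - 1))%:E.
  have mJ z : measurable_fun setT (J z).
    apply: emeasurable_funM; apply/measurable_EFinP; first exact: measurable_indic.
    apply: measurable_funM; last exact: measurable_powR_comp.
    have msc : measurable_fun setT (fun r : R => r *: z)%R by exact: measurable_scale_rV.
    exact: (measurableT_comp mps msc).
  have J0 z r : 0 <= J z r.
    by rewrite mule_ge0 ?lee_fin ?(mulr_ge0 (power_spectrum_ge0 _ _))// powR_ge0.
  have IE z : radial_moment K p z = \int[mu]_r J z r.
    by rewrite /radial_moment integral_indicM.
  rewrite !IE.
  apply: etrans (ge0_integral_affineR (a := t) 0 (lt0r_neq0 t0) (mJ y) (J0 y)) _.
  transitivity (t%:E * \int[mu]_r ((t `^ (p - 1))%:E * J (t *: y)%R r)).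
    rewrite gtr0_norm//; congr (_ * _); apply: eq_integral => r _.
    rewrite /J addr0 scalerA [(r * t)%R]mulrC.
    rewrite !indicE !mem_setE !in_itv/= !andbT pmulr_rgt0//.
    have [r0|_] := ltP 0%R r; last by rewrite !mul0e mule0.
    rewrite !mul1e -EFinM powRM ?ltW//.
    by congr (_%:E); ring.
  rewrite ge0_integralZl//; [|exact: mJ|by rewrite lee_fin powR_ge0].
  by rewrite muleA -EFinM mulr_powRB1// ltW.
have nn : 0 <= (p / fine (vol K))%:E * radial_moment K p (t *: y)%R.
  by rewrite mule_ge0 ?radial_moment_ge0// lee_fin divr_ge0 ?ltW.
rewrite muleCA [LHS]poweRM ?lee_fin ?powR_ge0//.
by rewrite poweR_EFin -powRrM divff ?gt_eqF// powRr1// ltW.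
Qed.

Context (T : 'M[R]_n) (x0 : 'rV[R]_n) (uT : T \in unitmx).

Let D : R := `|\det T|.
Let D0 : (0 < D)%R. Proof. exact: absdet_gt0. Qed.

Lemma fine_vol_affine_image : fine (vol (affine_image T x0 K)) = (D * V)%R.
Proof.
have := vol_affine_image x0 uT (convex_body_measurable cK).
by rewrite (convex_body_volE cK) -EFinM => /(congr1 fine).
Qed.

(** The power spectrum contributes D^2 and the division by the volume D^-1; the root of order p of
    the remaining D is the factor. *)
Lemma fourier_radial_affine_image (p : R) y : (0 < p)%R ->
  fourier_radial p (affine_image T x0 K) y =
  (D `^ p^-1)%:E * fourier_radial p K (y *m T^T).
Proof.
move=> p0.
have mps := measurable_power_spectrum (convex_body_measurable cK) (convex_body_volE cK).
have E : radial_moment (affine_image T x0 K) p y =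
    (D ^+ 2)%:E * radial_moment K p (y *m T^T).
  rewrite /radial_moment -ge0_integralZl//; first last.
  - by rewrite lee_fin sqr_ge0.
  - by move=> r _; rewrite lee_fin mulr_ge0 ?powR_ge0 ?power_spectrum_ge0.
  - apply/measurable_EFinP; apply: measurable_funTS; apply: measurable_funM.
      have msc : measurable_fun setT (fun r : R => r *: (y *m T^T))%R.
        exact: measurable_scale_rV.
      exact: (measurableT_comp mps msc).
    exact: measurable_powR_comp.
  apply: eq_integral => r _; rewrite -EFinM mulrA; congr ((_ * _)%:E).
  rewrite scalemxAl.
  exact: power_spectrum_affine_image (convex_body_measurable cK) (convex_body_volE cK).
rewrite !fourier_radialE E fine_vol_affine_image -/V -poweR_EFin.
rewrite -poweRM ?lee_fin ?(ltW D0)//; last first.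
  by rewrite mule_ge0 ?radial_moment_ge0// lee_fin divr_ge0// ltW.
congr (_ `^ _); rewrite !muleA -!EFinM; congr (_%:E * _).
by field; rewrite !gt_eqF.
Qed.

Lemma fourier_mean_body_affine_image (p : R) : (0 < p)%R ->
  fourier_mean_body p (affine_image T x0 K) =
  (fun x => x *m ((D `^ (- p^-1))%R *: T^T)) @^-1` (fourier_mean_body p K).
Proof.
move=> p0; apply: star_of_preimage.
- exact: powR_gt0.
- by rewrite unitmx_tr.
- by move=> t z t0; exact: fourier_radialZ.
- by move=> y; rewrite powRN invrK; exact: fourier_radial_affine_image.
Qed.

(** The matrix c T^t with c = D^(- 1/p) has determinant c^n D = D^((p - n)/p) in absolute value,
    exactly the power of D that the factor in front of the volume acquires. *)
Lemma vol_functional_affine_image (p : R) : (0 < p)%R ->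
  vol_functional p (affine_image T x0 K) = vol_functional p K.
Proof.
move=> p0; rewrite /vol_functional fine_vol_affine_image -/V.
rewrite (fourier_mean_body_affine_image p0).
set c := (D `^ _)%R; have c0 : (0 < c)%R by exact: powR_gt0.
set S := fourier_mean_body p K.
have mS : measurable S.
  apply: measurable_star_of.
  - exact: measurable_fourier_radial.
have uA : c *: T^T \in unitmx.
  by rewrite unitmxE detZ det_tr unitrM -unitmxE uT andbT unitrX// unitfE gt_eqF.
clearbody S; rewrite (vol_preimage_mulmx uA mS) muleA -EFinM; congr (_%:E * _).
rewrite detZ normrM det_tr -/D normrX gtr0_norm//.
rewrite powRM ?(ltW D0) ?(ltW V0)// mulrC; congr (_ * _)%R.
rewrite /c -powR_mulrn ?powR_ge0// -powRrM -[X in _ = (_ * X)%R](powRr1 (ltW D0)).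
rewrite -powRD ?(gt_eqF D0) ?implybT//; congr (_ `^ _)%R.
by field; rewrite gt_eqF.
Qed.

End affine_invariance.

Theorem proposition3 (R : realType) (n : nat) (n_gt0 : (0 < n)%N)
    (K : set 'rV[R]_n) (hK : convex_body K) :
  (Ln_star (fourier_mean_body n%:R K) /\
   vol (fourier_mean_body n%:R K) = ((2 * pi) ^+ n)%:E) /\
  ((forall p q : R, 0 < p -> p < q -> q <= n%:R ->
      star_sub (fourier_mean_body p K)
        (dilate (fine (vol K) `^ (p^-1 - q^-1)) (fourier_mean_body q K))) /\
   (forall p : R, 0 < p -> p <= n%:R -> Ln_star (fourier_mean_body p K))) /\
  (forall p : R, 0 < p -> p < n%:R ->
     forall (T : 'M[R]_n) (x0 : 'rV[R]_n), T \in unitmx ->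
       vol_functional p (affine_image T x0 K) = vol_functional p K).
Proof.
split; [split|split; [split|]].
- by apply: Ln_star_fourier_mean_body => //; rewrite ltr0n.
- exact: vol_fourier_mean_body.
- by move=> p q p0 pq _; exact: star_sub_fourier_mean_body.
- by move=> p p0 pn; exact: Ln_star_fourier_mean_body.
- by move=> p p0 _ T x0 uT; exact: vol_functional_affine_image.
Qed.
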